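(* Let $1\leq r\leq +\infty$ and let $f$ be a $C^r$ map of the interval $[0,1]$ (or of the circle $\mathbb{S}^1$). Then $$\limsup_{g \xrightarrow{C^r} f}h_{top}(g)\leq \max\left(h_{top}(f),\frac{R(f)}{r}\right),$$ where the $\limsup$ is taken over $C^r$ interval (resp. circle) maps $g$ converging to $f$ in the $C^r$ topology.
   Context: $h_{top}$ denotes topological entropy. For a $C^1$ map $f$, $R(f):=\lim_{n\to\infty}\frac{\log^+ \|(f^n)'\|_{\infty}}{n}$, where $\log^+=\max(\log,0)$ and $\|\cdot\|_\infty$ is the sup norm. For $r=+\infty$, $R(f)/r$ is interpreted as $0$. The spaces of $C^r$ maps carry the usual $C^r$ topology. *)

(* Defs.v *)
From Stdlib Require Import Reals Lra List.
From Coquelicot Require Import Coquelicot.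
Open Scope R_scope.

(** Regularity r in [1, +oo]: [Some m] is r = m, [None] is r = +oo. *)
Definition reg := option nat.
Definition le_r (k : nat) (r : reg) : Prop :=
  match r with Some m => (k <= m)%nat | None => True end.

Fixpoint iter (f : R -> R) (n : nat) (x : R) : R :=
  match n with O => x | S n' => f (iter f n' x) end.

(** The interval [0,1] and the fundamental domain [0,1) of the circle R/Z. *)
Definition I01 (x : R) : Prop := 0 <= x <= 1.
Definition C01 (x : R) : Prop := 0 <= x < 1.
Definition whole (x : R) : Prop := True.

Definition dI (x y : R) : R := Rabs (x - y).
Definition dC (x y : R) : R :=
  let t := (x - y) - IZR (Int_part (x - y)) in Rmin t (1 - t).

Definition has_deriv_within (U : R -> Prop) (g : R -> R) (x L : R) : Prop :=
  forall eps, 0 < eps -> exists delta, 0 < delta /\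
    forall y, U y -> y <> x -> Rabs (y - x) < delta ->
      Rabs ((g y - g x) / (y - x) - L) < eps.

Definition cont_within (U : R -> Prop) (g : R -> R) : Prop :=
  forall x, U x -> forall eps, 0 < eps -> exists delta, 0 < delta /\
    forall y, U y -> Rabs (y - x) < delta -> Rabs (g y - g x) < eps.

Definition CrOn (U : R -> Prop) (r : reg) (f : R -> R) (D : nat -> R -> R) : Prop :=
  (forall x, U x -> D O x = f x) /\
  (forall k, le_r (S k) r -> forall x, U x -> has_deriv_within U (D k) x (D (S k) x)) /\
  (forall k, le_r k r -> cont_within U (D k)).

Definition IntervalMap (r : reg) (f : R -> R) : Prop :=
  (forall x, I01 x -> I01 (f x)) /\ exists D, CrOn I01 r f D.

(** C^r maps of the circle, given by a lift F : R -> R (F(x+1) = F(x) + deg) *)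
Definition CircleMap (r : reg) (F : R -> R) : Prop :=
  (exists d : Z, forall x, F (x + 1) = F x + IZR d) /\ exists D, CrOn whole r F D.

(** Topological entropy (Bowen, via (n,eps)-separated sets) of f on the
    compact space represented by the points of D with metric d. *)
Definition separated (D : R -> Prop) (d : R -> R -> R) (f : R -> R)
  (n : nat) (eps : R) (l : list R) : Prop :=
  NoDup l /\ (forall x, In x l -> D x) /\
  forall x y, In x l -> In y l -> x <> y ->
    exists k, (k < n)%nat /\ eps < d (iter f k x) (iter f k y).

Definition sep_max (D : R -> Prop) (d : R -> R -> R) (f : R -> R) (n : nat) (eps : R) : Rbar :=
  Lub_Rbar (fun t => exists l, separated D d f n eps l /\ t = INR (length l)).

Definition htop (D : R -> Prop) (d : R -> R -> R) (f : R -> R) : Rbar :=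
  Rbar_lub (fun v => exists eps, 0 < eps /\
    v = LimSup_seq (fun n => ln (real (sep_max D d f n eps)) / INR n)).

Definition htop_interval (f : R -> R) : Rbar := htop I01 dI f.
Definition htop_circle (F : R -> R) : Rbar := htop C01 dC F.

Definition sup_deriv (U : R -> Prop) (g : R -> R) : Rbar :=
  Lub_Rbar (fun t => exists x L, U x /\ has_deriv_within U g x L /\ t = Rabs L).

Definition log_plus (x : R) : R := Rmax (ln x) 0.

Definition Rrate (U : R -> Prop) (f : R -> R) : Rbar :=
  Lim_seq (fun n => log_plus (real (sup_deriv U (iter f n))) / INR n).

Definition div_r (x : Rbar) (r : reg) : Rbar :=
  match r with Some m => Rbar_mult x (Finite (/ INR m)) | None => Finite 0 end.

Definition Rbar_max (x y : Rbar) : Rbar := if Rbar_le_dec x y then y else x.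

Definition CkClose (U : R -> Prop) (d0 : R -> R -> R) (k : nat)
  (f g : R -> R) (delta : R) : Prop :=
  exists Df Dg, CrOn U (Some k) f Df /\ CrOn U (Some k) g Dg /\
    (forall x, U x -> d0 (f x) (g x) <= delta) /\
    (forall j x, (1 <= j <= k)%nat -> U x -> Rabs (Df j x - Dg j x) <= delta).

(** limsup_{g -> f in C^r, P g} H g = inf over basic C^r-neighbourhoods
    {g | C^k-close within delta}, k <= r finite, delta > 0, of sup H. *)
Definition Cr_limsup (U : R -> Prop) (d0 : R -> R -> R) (P : reg -> (R -> R) -> Prop)
  (r : reg) (H : (R -> R) -> Rbar) (f : R -> R) : Rbar :=
  Rbar_glb (fun s => exists k delta, le_r k r /\ 0 < delta /\
    s = Rbar_lub (fun t => exists g, P r g /\ CkClose U d0 k f g delta /\ t = H g)).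

(* Main.v *)
(** The entropy of a map [g] close to [f] is bounded by counting points that [g^k] separates.

    An interval of length [x] either splits into boundedly many monotone pieces, or [|g'|] is at
    most [B x^(r-1)] on it, so that its image has length at most [B x^r].  Bisecting until the
    first alternative holds, [2^i] pieces are paid for by images of length about [2^(-ir)]; while
    such an image grows back to a fixed scale [Delta], at the rate [R(f)], nothing has to be
    counted.  This costs entropy at most [R(f)/r] during these times.  An interval that has
    reached the scale [Delta] is covered by the dynamical balls of [f] of a fixed length [N],
    which costs [h_top(f)].  These two activities alternate in time instead of being superposed,
    whence the maximum and not the sum.

    The constants lost at visits near a critical point must be negligible.  Visits with
    [|g'| <= sigma] are therefore weighted by [max(|g'|^3, omega)], where [Delta] and [N], hence
    [omega], depend on [sigma].  This bounds the number of orbits whose total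
    weight is not too small.  In a long chain of windows [(sigma_i, omega_i)] with
    [sigma_(i+1) <= omega_0 ... omega_i] the product of all the weights is at least
    [min(1,|g'|)^4]; hence an orbit along which the derivative of [g^k] is not small loses, per
    step, a factor close to 1 in at least one of the windows. *)

Require Import Defs.
From Stdlib Require Znat.
From Stdlib Require Import Arith Reals Lra Lia List Classical ClassicalEpsilon FinFun.
From Coquelicot Require Import Coquelicot.
Open Scope R_scope.

(** * Weighted sums over finite sets *)

(** The order of the quantifiers shapes the proof. The entropy of g takes all scales into account,
    while the neighbourhood of f has to be fixed beforehand. Hence sigma, Delta, N, omega and the
    radius tau are all chosen before the scale eta of separation, which enters only the
    multiplicative constants. Orbits along which the derivative of g^k is not small suffice for the
    following reason. Two neighbours in a separated set are pulled apart at some time k, and the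
    mean value theorem puts between them a point where |(g^k)'| >= eta. These points are counted for
    each k separately, which costs a factor linear in time. One window would not do: along such an
    orbit its weight may still decay at a fixed exponential rate. The product of the weights of a
    chain, however, decays at a rate of at most 4 log M, M being a bound of the derivatives,
    whatever the number L of windows. So one window loses at most (4 log M)/L per step. The points
    are distributed over the windows, so that L multiplies the count and no entropies are added. For
    r = +oo, a finite order r with exp(r rho) > sup |f'| is used, where rho > h_top(f) is positive
    and may be small. *)

Fixpoint wsum (w : R -> R) (l : list R) : R :=
  match l with nil => 0 | x :: l' => w x + wsum w l' end.

Lemma wsum_nonneg (w : R -> R) (l : list R) :
  (forall x, In x l -> 0 <= w x) -> 0 <= wsum w l.
Proof.
  induction l as [|x l IH]; simpl; intros H; [lra|].
  assert (0 <= w x) by (apply H; auto).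
  assert (0 <= wsum w l) by (apply IH; auto).
  lra.
Qed.

Lemma wsum_le (w1 w2 : R -> R) (l : list R) :
  (forall x, In x l -> w1 x <= w2 x) -> wsum w1 l <= wsum w2 l.
Proof.
  induction l as [|x l IH]; simpl; intros H; [lra|].
  assert (w1 x <= w2 x) by (apply H; auto).
  assert (wsum w1 l <= wsum w2 l) by (apply IH; auto).
  lra.
Qed.

Lemma wsum_scal (c : R) (w : R -> R) (l : list R) :
  wsum (fun x => c * w x) l = c * wsum w l.
Proof. induction l as [|x l IH]; simpl; [ring | rewrite IH; ring]. Qed.

Lemma wsum_map (w g : R -> R) (l : list R) :
  wsum w (map g l) = wsum (fun x => w (g x)) l.
Proof. induction l as [|x l IH]; simpl; [ring | rewrite IH; ring]. Qed.

Lemma wsum_const (c : R) (l : list R) : wsum (fun _ => c) l = c * INR (length l).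
Proof.
  induction l as [|x l IH]; [simpl; ring|].
  cbn [wsum length]. rewrite IH, S_INR. ring.
Qed.

Definition decb (P : Prop) : bool :=
  if excluded_middle_informative P then true else false.

Lemma decb_true (P : Prop) : decb P = true <-> P.
Proof.
  unfold decb. destruct (excluded_middle_informative P); split; intros; try easy.
Qed.

Lemma decb_false (P : Prop) : negb (decb P) = true <-> ~ P.
Proof.
  unfold decb. destruct (excluded_middle_informative P); split; intros; try easy.
Qed.

Lemma wsum_split (w : R -> R) (f : R -> bool) (l : list R) :
  wsum w l = wsum w (filter f l) + wsum w (filter (fun x => negb (f x)) l).
Proof.
  induction l as [|x l IH]; simpl; [ring|].
  rewrite IH. destruct (f x); simpl; ring.
Qed.

(** The classes may overlap: each point is charged to the first class that contains it. This is why
    the bound [X] is assumed for every subset of a class. *)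
Lemma wsum_cover (A : Type) (P : A -> R -> Prop) (w : R -> R) (X : R) (T : list A) :
  forall Y : list R, NoDup Y ->
  (forall x, In x Y -> exists a, In a T /\ P a x) ->
  (forall a, In a T -> forall Y', NoDup Y' -> incl Y' Y ->
     (forall x, In x Y' -> P a x) -> wsum w Y' <= X) ->
  wsum w Y <= INR (length T) * X.
Proof.
  induction T as [|a T IH]; intros Y HY Hc HX.
  - destruct Y as [|x Y]; [simpl; lra|].
    destruct (Hc x) as [a [[] _]]. now left.
  - cbn [length]. rewrite S_INR.
    rewrite (wsum_split w (fun x => decb (P a x)) Y).
    assert (H1 : wsum w (filter (fun x => decb (P a x)) Y) <= X).
    { apply (HX a); [now left | now apply NoDup_filter | apply incl_filter |].
      intros x Hx. apply filter_In in Hx. now apply decb_true. }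
    assert (H2 : wsum w (filter (fun x => negb (decb (P a x))) Y) <= INR (length T) * X).
    { apply IH.
      - now apply NoDup_filter.
      - intros x Hx. apply filter_In in Hx as [Hx Hn]. apply decb_false in Hn.
        destruct (Hc x Hx) as [b [[->|Hb] Hp]]; [easy|]. now exists b.
      - intros b Hb Y' Hd Hi Hp. apply (HX b); [now right | easy | | easy].
        intros z Hz. now apply (incl_filter (fun x => negb (decb (P a x))) Y), Hi. }
    lra.
Qed.

Lemma list_Rmin (Y : list R) : Y <> nil -> exists m, In m Y /\ forall y, In y Y -> m <= y.
Proof.
  induction Y as [|x Y IH]; intros H; [easy|].
  destruct Y as [|x' Y].
  - exists x. split; [now left|]. intros y [->|[]]; lra.
  - destruct IH as [m [Hm H1]]; [easy|].
    destruct (Rle_dec x m) as [Hx|Hx].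
    + exists x. split; [now left|]. intros y [->|Hy]; [lra|].
      specialize (H1 y Hy). lra.
    + exists m. split; [now right|]. intros y [->|Hy]; [lra | now apply H1].
Qed.

Lemma list_Rmax (Y : list R) : Y <> nil -> exists m, In m Y /\ forall y, In y Y -> y <= m.
Proof.
  intros H. destruct (list_Rmin (map Ropp Y)) as [m [Hm H1]].
  - now destruct Y.
  - apply in_map_iff in Hm as [x [<- Hx]]. exists x. split; [easy|].
    intros y Hy. specialize (H1 (- y) (in_map _ _ _ Hy)). lra.
Qed.

(** Deleting the maximum leaves points in an interval that is shorter by at least [d]. *)
Lemma count_separated (d : R) (Y : list R) : 0 < d -> NoDup Y ->
  (forall x y, In x Y -> In y Y -> x <> y -> d <= Rabs (x - y)) ->
  forall lo hi, lo <= hi -> (forall x, In x Y -> lo <= x <= hi) ->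
  INR (length Y) <= (hi - lo) / d + 1.
Proof.
  intros Hd. remember (length Y) as n eqn:En. revert Y En.
  induction n as [|n IH]; intros Y En HN Hs lo hi Hl Hb.
  - simpl. assert (0 <= (hi - lo) / d) by (apply Rcomplements.Rdiv_le_0_compat; lra). lra.
  - assert (HY : Y <> nil) by (intros ->; easy).
    destruct (list_Rmax Y HY) as [m [Hm H1]].
    destruct (in_split _ _ Hm) as [l1 [l2 ->]].
    assert (HN' := NoDup_remove_1 _ _ _ HN). assert (Hni := NoDup_remove_2 _ _ _ HN).
    assert (En' : n = length (l1 ++ l2)).
    { rewrite length_app in *. simpl in En. lia. }
    assert (Hin : forall x, In x (l1 ++ l2) -> In x (l1 ++ m :: l2)).
    { intros x Hx. apply in_app_or in Hx. apply in_or_app. simpl. tauto. }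
    destruct n as [|n].
    + simpl. assert (0 <= (hi - lo) / d) by (apply Rcomplements.Rdiv_le_0_compat; lra). lra.
    + assert (Hgap : forall x, In x (l1 ++ l2) -> x <= m - d).
      { intros x Hx. assert (x <> m) by (intros ->; easy).
        assert (Hs1 := Hs x m (Hin x Hx) Hm H). specialize (H1 x (Hin x Hx)).
        rewrite Rabs_left1 in Hs1 by lra. lra. }
      assert (Hlo : lo <= m - d).
      { destruct (l1 ++ l2) as [|z l] eqn:El; [easy|].
        assert (Hz : In z (z :: l)) by now left.
        specialize (Hgap z Hz). specialize (Hb z (Hin z Hz)). lra. }
      assert (Hm' := Hb m Hm).
      assert (K : INR (S n) <= (m - d - lo) / d + 1).
      { apply (IH (l1 ++ l2)); auto.
        intros x Hx. split; [now apply Hb, Hin | now apply Hgap]. }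
      rewrite S_INR.
      replace ((m - d - lo) / d) with ((m - lo) / d - 1) in K by (field; lra).
      assert ((m - lo) / d <= (hi - lo) / d).
      { apply Rmult_le_compat_r; [left; now apply Rinv_0_lt_compat | lra]. }
      lra.
Qed.

Lemma iter_S_r (g : R -> R) (n : nat) (x : R) : iter g (S n) x = iter g n (g x).
Proof. induction n as [|n IH]; [easy|]. simpl in *. now rewrite IH. Qed.

Lemma iter_add (g : R -> R) (n m : nat) (x : R) : iter g (n + m) x = iter g n (iter g m x).
Proof. induction n as [|n IH]; [easy|]. simpl. now rewrite IH. Qed.

Lemma iter_in (U : R -> Prop) (g : R -> R) (n : nat) (x : R) :
  (forall y, U y -> U (g y)) -> U x -> U (iter g n x).
Proof. intros Hg Hx. induction n as [|n IH]; simpl; auto. Qed.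

(** * The counting estimate in one window *)

Definition mono (g : R -> R) (u v : R) : Prop :=
  (forall x y, u <= x -> x <= y -> y <= v -> g x <= g y) \/
  (forall x y, u <= x -> x <= y -> y <= v -> g y <= g x).

(** Below the threshold the cube is at most sigma |v|^2: the square makes the weight of a critical
    piece linear in its length, and the factor sigma absorbs the constants. In a chain, every active
    window except the last is bounded below by its floor omega. *)
Definition phi (sigma omega v : R) : R :=
  if Rle_dec (Rabs v) sigma then Rmax (Rabs v ^ 3) omega else 1.

Fixpoint weight (g g1 : R -> R) (sigma omega : R) (t : nat) (y : R) : R :=
  match t with
  | O => 1
  | S t' => phi sigma omega (g1 y) * weight g g1 sigma omega t' (g y)
  end.

(** An oscillation inside the gap replaces the separation of the two points themselves. The points
    to be counted are chosen inside the gaps of a separated set, where only a part of the original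
    jump is known to lie between consecutive ones. *)
Definition good (g : R -> R) (eta : R) (t : nat) (Y : list R) : Prop :=
  forall y y', In y Y -> In y' Y -> y < y' ->
  exists u v, y <= u <= y' /\ y <= v <= y' /\ eta < Rabs (iter g t u - iter g t v).

Definition split_mono (g : R -> R) (c : nat) (u v : R) : Prop :=
  exists T : list (R * R), (length T <= c)%nat /\
    (forall x, u <= x <= v -> exists p, In p T /\ fst p <= x <= snd p) /\
    (forall p, In p T -> u <= fst p /\ fst p <= snd p /\ snd p <= v /\ mono g (fst p) (snd p)).

Lemma good_incl g eta t Y Y' : incl Y' Y -> good g eta t Y -> good g eta t Y'.
Proof. intros Hi H y y' Hy Hy'. apply H; auto. Qed.

Lemma pow_ge_1 (x : R) (n : nat) : 1 <= x -> 1 <= x ^ n.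
Proof. apply pow_R1_Rle. Qed.

Lemma pow_le_self (x : R) (n : nat) : 0 <= x <= 1 -> (1 <= n)%nat -> x ^ n <= x.
Proof.
  intros Hx Hn. destruct n as [|n]; [lia|]. simpl.
  assert (0 <= x ^ n <= 1).
  { split; [now apply pow_le|]. rewrite <- (pow1 n). now apply pow_incr. }
  nra.
Qed.

Lemma self_le_pow (x : R) (n : nat) : 1 <= x -> (1 <= n)%nat -> x <= x ^ n.
Proof.
  intros Hx Hn. destruct n as [|n]; [lia|]. simpl.
  assert (1 <= x ^ n) by now apply pow_ge_1. nra.
Qed.

(* The regularity is [r = S r1], and [E] stands for the exponential of the growth rate that bounds
   both [h_top(f)] (through [Hcover]) and [R(f)/r] (through [Hadapt]). *)
Section Core.

Variables (U : R -> Prop) (g g1 : R -> R) (r1 cr N : nat).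
Variables (E B Cp Delta sigma omega eta : R).

Hypothesis Hconv : forall x y z, U x -> U y -> x <= z <= y -> U z.
Hypothesis HgU : forall x, U x -> U (g x).
Hypothesis Hivt : forall u v c, U u -> U v -> u <= v ->
  Rmin (g u) (g v) <= c <= Rmax (g u) (g v) -> exists x, u <= x <= v /\ g x = c.
Hypothesis Hctr : forall u v m, U u -> U v -> u <= v ->
  (forall z, u <= z <= v -> Rabs (g1 z) <= m) ->
  forall x y, u <= x <= v -> u <= y <= v -> Rabs (g x - g y) <= m * (v - u).
Hypothesis Hadapt : forall j x y, U x -> U y ->
  Rabs (iter g j x - iter g j y) <= Cp * (E ^ j) ^ S r1 * Rabs (x - y).
Hypothesis Hsplit : forall u v, U u -> U v -> u <= v -> v - u <= 1 ->
  split_mono g cr u v \/ forall z, u <= z <= v -> Rabs (g1 z) <= B * (v - u) ^ r1.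
Hypothesis Hreg : forall u v, U u -> U v -> u <= v -> v - u <= Delta ->
  mono g u v \/ forall z, u <= z <= v -> Rabs (g1 z) <= sigma.
Hypothesis Hcover : forall lo hi, U lo -> U hi -> lo <= hi -> hi - lo <= 1 ->
  exists T : list (R -> Prop), INR (length T) <= E ^ N /\
    (forall y, lo <= y <= hi -> exists P, In P T /\ P y) /\
    (forall P, In P T -> forall y y', lo <= y <= hi -> lo <= y' <= hi -> P y -> P y' ->
       forall j, (j < N)%nat -> Rabs (iter g j y - iter g j y') <= Delta).

Hypothesis Hr1 : (1 <= r1)%nat.
Hypothesis HN : (1 <= N)%nat.
Hypothesis Hcr : (1 <= cr)%nat.
Hypothesis HE : 1 <= E.
Hypothesis HB : 1 <= B.
Hypothesis HCp : 1 <= Cp.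
Hypothesis HDelta : 0 < Delta <= 1.
Hypothesis HDelta1 : Cp * E ^ S r1 * Delta <= 1.
Hypothesis Hsigma : 0 < sigma.
Hypothesis Hsigma1 : 4 * INR cr * 4 ^ r1 * B ^ 2 * sigma <= 1.
Hypothesis Homega : 0 < omega.
Hypothesis Homega1 : 4 * INR cr * (Cp * B) * E ^ N * omega <= Delta.
Hypothesis Heta : 0 < eta <= 1.

Let w := weight g g1 sigma omega.
Let C2 := Cp * B.

(** When [b <= N] and [eta <= q * E ^ t], the remaining factor of the bound below is at least eta /
    E^N. The constant makes the product at least 1/eta + 1, the number of eta-separated points in an
    interval of length 1. *)
Definition core_const : R := (/ eta + 1) * E ^ N / eta.
(* [b] is the number of remaining steps along a dynamical ball that has already been paid for,
   and [q^r] the size of the interval, see [adapted]; the second term of the minimum says that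
   an interval below the scale [Delta] is not counted before it has grown back. *)
Definition core_bound (t b : nat) (q : R) : R :=
  core_const * E ^ t * Rmin (/ E ^ b) (q / Delta).

(* A size that one step multiplies by exactly [E^r], although [|g'|] may exceed [E^r] pointwise. *)
Definition adapted (lo hi q : R) : Prop :=
  forall x y, lo <= x <= hi -> lo <= y <= hi ->
  forall j, Rabs (iter g j x - iter g j y) <= (q * E ^ j) ^ S r1.

Definition tracked (b : nat) (Y : list R) : Prop :=
  forall y y', In y Y -> In y' Y ->
  forall j, (j < b)%nat -> Rabs (iter g j y - iter g j y') <= Delta.

(** Here [t] is the number of iterates still to come. The floor [st_q] keeps [core_bound] above 1,
    so that a single point is always affordable. Intervals too small for the floor oscillate by less
    than [eta] at the final time and carry at most one point. *)
Record state (t b : nat) (q lo hi : R) (Y : list R) : Prop := mk_state {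
  st_lo : U lo;
  st_hi : U hi;
  st_le : lo <= hi;
  st_len : hi - lo <= 1;
  st_nodup : NoDup Y;
  st_in : forall y, In y Y -> lo <= y <= hi;
  st_good : good g eta t Y;
  st_b : (b <= N)%nat;
  st_tracked : tracked b Y;
  st_q : eta <= q * E ^ t;
  st_adapted : adapted lo hi q }.

Definition claim (t : nat) : Prop := forall b q lo hi Y,
  state t b q lo hi Y -> wsum (w t) Y <= core_bound t b q.

Let HEpow (n : nat) : 1 <= E ^ n.
Proof. now apply pow_ge_1. Qed.

Let HC2 : 1 <= C2.
Proof. unfold C2. nra. Qed.

Let Hcr1 : 1 <= INR cr.
Proof. apply (le_INR 1), Hcr. Qed.

Let H4 : 1 <= 4 ^ r1.
Proof. apply pow_ge_1. lra. Qed.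

Let HB2 : 1 <= B ^ 2.
Proof. now apply pow_ge_1. Qed.

Let sigma_small : 4 * INR cr * sigma <= 1.
Proof.
  apply Rle_trans with (2 := Hsigma1).
  assert (1 <= 4 ^ r1 * B ^ 2) by nra.
  assert (0 <= 4 * INR cr * sigma) by nra.
  replace (4 * INR cr * 4 ^ r1 * B ^ 2 * sigma)
    with (4 * INR cr * sigma * (4 ^ r1 * B ^ 2)) by ring.
  nra.
Qed.

Let omega_small : 4 * INR cr * omega <= 1.
Proof.
  assert (1 <= C2 * E ^ N) by (specialize (HEpow N); nra).
  assert (0 <= 4 * INR cr * omega) by nra.
  replace (4 * INR cr * (Cp * B) * E ^ N * omega)
    with (4 * INR cr * omega * (C2 * E ^ N)) in Homega1 by (unfold C2; ring).
  nra.
Qed.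

Lemma phi_bounds (v : R) : 0 <= phi sigma omega v <= 1.
Proof.
  unfold phi. destruct (Rle_dec (Rabs v) sigma) as [H|H]; [|lra].
  assert (0 <= Rabs v) by apply Rabs_pos.
  assert (sigma <= 1) by nra. assert (omega <= 1) by nra.
  split.
  - apply Rle_trans with omega; [lra | apply Rmax_r].
  - apply Rmax_lub; [|easy]. rewrite <- (pow1 3). apply pow_incr. lra.
Qed.

Lemma phi_small (v : R) : Rabs v <= sigma -> phi sigma omega v <= sigma * Rabs v ^ 2 + omega.
Proof.
  intros H. unfold phi. destruct (Rle_dec (Rabs v) sigma) as [_|]; [|easy].
  assert (0 <= Rabs v) by apply Rabs_pos.
  apply Rmax_lub; simpl; nra.
Qed.

Lemma weight_bounds (t : nat) (y : R) : 0 <= w t y <= 1.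
Proof.
  unfold w. revert y. induction t as [|t IH]; intros y; simpl; [lra|].
  assert (H := phi_bounds (g1 y)). specialize (IH (g y)). nra.
Qed.

Lemma core_const_pos : 1 <= core_const.
Proof.
  unfold core_const. assert (H := HEpow N).
  assert (1 <= / eta).
  { rewrite <- Rinv_1. apply Rinv_le_contravar; lra. }
  unfold Rdiv. assert (1 <= (/ eta + 1) * E ^ N) by nra. nra.
Qed.

Lemma core_const_floor : eta * / E ^ N * core_const = / eta + 1.
Proof.
  unfold core_const. assert (H := HEpow N). field. lra.
Qed.

Lemma core_bound_ge (t b : nat) (q : R) : (b <= N)%nat -> eta <= q * E ^ t ->
  / eta + 1 <= core_bound t b q.
Proof.
  intros Hb Hq. rewrite <- core_const_floor. unfold core_bound.
  assert (Hc := core_const_pos). assert (Ht := HEpow t). assert (HNp := HEpow N).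
  assert (Hi : 0 < / E ^ N <= 1).
  { split; [apply Rinv_0_lt_compat; lra|]. rewrite <- Rinv_1. apply Rinv_le_contravar; lra. }
  rewrite (Rmult_comm _ core_const), Rmult_assoc.
  apply Rmult_le_compat_l; [lra|].
  unfold Rmin. destruct (Rle_dec (/ E ^ b) (q / Delta)).
  - assert (/ E ^ N <= / E ^ b).
    { apply Rinv_le_contravar; [specialize (HEpow b); lra|]. now apply Rle_pow. }
    nra.
  - apply Rle_trans with (q * E ^ t); [nra|].
    assert (0 < q) by nra.
    assert (q <= q / Delta).
    { apply Rle_div_r; [lra|]. nra. }
    nra.
Qed.

Lemma core_bound_ge_1 (t b : nat) (q : R) : (b <= N)%nat -> eta <= q * E ^ t ->
  1 <= core_bound t b q.
Proof.
  intros Hb Hq. assert (H := core_bound_ge t b q Hb Hq).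
  assert (0 < / eta) by (apply Rinv_0_lt_compat; lra). lra.
Qed.

Lemma good_single (t : nat) (lo hi : R) (Y : list R) : NoDup Y ->
  (forall y, In y Y -> lo <= y <= hi) -> good g eta t Y ->
  (forall x y, lo <= x <= hi -> lo <= y <= hi -> Rabs (iter g t x - iter g t y) <= eta) ->
  (length Y <= 1)%nat.
Proof.
  intros Hd Hin Hg Ho. destruct Y as [|a [|b Y]]; simpl; try lia. exfalso.
  assert (Hab : a <> b).
  { intros ->. inversion Hd. apply H1. now left. }
  assert (Ha : In a (a :: b :: Y)) by now left.
  assert (Hb : In b (a :: b :: Y)) by (right; now left).
  assert (Ia := Hin a Ha). assert (Ib := Hin b Hb).
  destruct (Rtotal_order a b) as [H|[H|H]]; [|easy|].
  - destruct (Hg a b Ha Hb H) as [u [v [Hu [Hv H2]]]].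
    specialize (Ho u v). lra.
  - destruct (Hg b a Hb Ha) as [u [v [Hu [Hv H2]]]]; [lra|].
    specialize (Ho u v). lra.
Qed.

(** No point is lost under a monotone step: a collision would make [g] constant between two points
    of a good set, which leaves no oscillation. Gaps are mapped to gaps, possibly in reverse order.
    By the intermediate value property each point between the endpoint images is an image, so the
    size passes to the image interval. *)
Lemma push_mono (t b : nat) (q u v : R) (Y : list R) :
  claim t -> U u -> U v -> u <= v -> v - u <= Delta -> mono g u v -> NoDup Y ->
  (forall y, In y Y -> u <= y <= v) -> good g eta (S t) Y -> (b <= N)%nat ->
  (forall y y', In y Y -> In y' Y -> forall j, (j < b)%nat ->
     Rabs (iter g (S j) y - iter g (S j) y') <= Delta) ->
  eta <= q * E ^ t ->
  (forall x y, u <= x <= v -> u <= y <= v ->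
     forall j, Rabs (iter g (S j) x - iter g (S j) y) <= (q * E ^ j) ^ S r1) ->
  wsum (fun y => w t (g y)) Y <= core_bound t b q.
Proof.
  intros Hcl Uu Uv Huv Hlen Hm Hd Hin Hg Hb Htr Hq Had.
  rewrite <- wsum_map.
  apply (Hcl b q (Rmin (g u) (g v)) (Rmax (g u) (g v))).
  assert (Hbet : forall x y z, u <= x -> x <= z <= y -> y <= v ->
     Rmin (g x) (g y) <= g z <= Rmax (g x) (g y)).
  { intros x y z H1 H2 H3.
    assert (Ha := Rmin_l (g x) (g y)). assert (Hb' := Rmin_r (g x) (g y)).
    assert (Hc := Rmax_l (g x) (g y)). assert (Hd' := Rmax_r (g x) (g y)).
    destruct Hm as [Hm|Hm];
    assert (K1 := Hm x z H1 ltac:(lra) ltac:(lra));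
    assert (K2 := Hm z y ltac:(lra) ltac:(lra) H3); lra. }
  split.
  - unfold Rmin; destruct Rle_dec; auto.
  - unfold Rmax; destruct Rle_dec; auto.
  - apply Rle_trans with (g u); [apply Rmin_l | apply Rmax_l].
  (* [HDelta1] keeps the image of an interval below the scale [Delta] shorter than 1. *)
  - assert (H := Hadapt 1 u v Uu Uv). simpl iter in H. rewrite pow_1 in H.
    assert (Hl : Rabs (u - v) <= Delta) by (rewrite Rabs_left1; lra).
    assert (Hk : 0 <= Cp * E ^ S r1) by (specialize (HEpow (S r1)); nra).
    assert (Rabs (g u - g v) <= 1) by nra.
    revert H0. unfold Rmax, Rmin, Rabs. destruct Rle_dec, Rcase_abs; lra.
  - apply Injective_map_NoDup_in; [|easy].
    assert (Haux : forall y y', In y Y -> In y' Y -> g y = g y' -> ~ y < y').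
    { intros y y' Hy Hy' He Hlt.
      assert (Iy := Hin y Hy). assert (Iy' := Hin y' Hy').
      destruct (Hg y y' Hy Hy' Hlt) as [a [c [Ha [Hc H2]]]].
      assert (Ea := Hbet y y' a ltac:(lra) Ha ltac:(lra)).
      assert (Ec := Hbet y y' c ltac:(lra) Hc ltac:(lra)).
      rewrite He in Ea, Ec.
      rewrite Rmin_left, Rmax_left in Ea, Ec by lra.
      rewrite 2!iter_S_r in H2. replace (g a) with (g c) in H2 by lra.
      rewrite Rminus_diag, Rabs_R0 in H2. lra. }
    intros y y' Hy Hy' He.
    assert (K1 := Haux y y' Hy Hy' He). assert (K2 := Haux y' y Hy' Hy (eq_sym He)). lra.
  - intros z Hz. apply in_map_iff in Hz as [y [<- Hy]].
    apply Hbet; try lra. now apply Hin.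
  - intros z z' Hz Hz' Hlt.
    apply in_map_iff in Hz as [y [<- Hy]]. apply in_map_iff in Hz' as [y' [<- Hy']].
    assert (Iy := Hin y Hy). assert (Iy' := Hin y' Hy').
    destruct (Rtotal_order y y') as [H|[H|H]].
    + destruct (Hg y y' Hy Hy' H) as [a [c [Ha [Hc H2]]]].
      rewrite 2!iter_S_r in H2. exists (g a), (g c).
      assert (Ea := Hbet y y' a ltac:(lra) Ha ltac:(lra)).
      assert (Ec := Hbet y y' c ltac:(lra) Hc ltac:(lra)).
      rewrite Rmin_left, Rmax_right in Ea, Ec by lra. easy.
    + subst. lra.
    + destruct (Hg y' y Hy' Hy ltac:(lra)) as [a [c [Ha [Hc H2]]]].
      rewrite 2!iter_S_r in H2. exists (g a), (g c).
      assert (Ea := Hbet y' y a ltac:(lra) Ha ltac:(lra)).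
      assert (Ec := Hbet y' y c ltac:(lra) Hc ltac:(lra)).
      rewrite Rmin_right, Rmax_left in Ea, Ec by lra. easy.
  - easy.
  - intros z z' Hz Hz' j Hj.
    apply in_map_iff in Hz as [y [<- Hy]]. apply in_map_iff in Hz' as [y' [<- Hy']].
    rewrite <- 2!iter_S_r. now apply Htr.
  - easy.
  - intros z z' Hz Hz' j.
    destruct (Hivt u v z Uu Uv Huv Hz) as [x [Hx <-]].
    destruct (Hivt u v z' Uu Uv Huv Hz') as [x' [Hx' <-]].
    rewrite <- 2!iter_S_r. now apply Had.
Qed.

(** The image of a node of length x in the bisection has size [2 * C2 * x]; with the term q / Delta
    of the minimum its bound becomes linear in x. *)
Let slope : R := core_const * (2 * C2) / Delta.

Lemma core_bound_linear (t b : nat) (x : R) :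
  core_bound t b (2 * C2 * x) <= slope * E ^ t * x.
Proof.
  unfold core_bound, slope.
  assert (Hc := core_const_pos). assert (Ht := HEpow t).
  apply Rle_trans with (core_const * E ^ t * (2 * C2 * x / Delta)).
  - apply Rmult_le_compat_l; [nra | apply Rmin_r].
  - right. field. lra.
Qed.

(** This is a bound per unit length, with one summand for each part of the weight. The part with
    [sigma] is itself linear in the length, so the image may be bounded by the size inherited from
    the whole interval. The part [omega] is constant, so the length has to come from the size of the
    image of the node. *)
Definition node_bound (t b : nat) (q : R) : R :=
  INR cr * (sigma * 4 ^ r1 * B ^ 2 * core_bound t b (E * q) + omega * (slope * E ^ t)).

(** The derivative bound is inherited from an interval up to twice as long, whence the power of 4.
    Its square contains (v - u)^(2 r1), which is at most v - u since the length is at most 1 and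
    [r1] is positive. *)
Lemma node_weight (u v : R) (y : R) : u <= y <= v -> v - u <= 1 ->
  (forall z, u <= z <= v -> Rabs (g1 z) <= sigma) ->
  (forall z, u <= z <= v -> Rabs (g1 z) <= B * (2 * (v - u)) ^ r1) ->
  phi sigma omega (g1 y) <= sigma * 4 ^ r1 * B ^ 2 * (v - u) + omega.
Proof.
  intros Hy Hl Hs HBz. apply Rle_trans with (1 := phi_small _ (Hs y Hy)).
  apply Rplus_le_compat_r.
  rewrite 2!Rmult_assoc. apply Rmult_le_compat_l; [lra|].
  apply Rle_trans with ((B * (2 * (v - u)) ^ r1) ^ 2).
  - apply pow_incr. split; [apply Rabs_pos | now apply HBz].
  - rewrite Rpow_mult_distr, <- (pow_mult _ r1 2), (Nat.mul_comm r1 2), pow_mult.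
    replace ((2 * (v - u)) ^ 2) with (4 * (v - u) ^ 2) by ring.
    rewrite Rpow_mult_distr.
    assert (((v - u) ^ 2) ^ r1 <= v - u).
    { rewrite <- pow_mult. apply pow_le_self; [lra | lia]. }
    assert (0 <= 4 ^ r1 * B ^ 2) by nra. nra.
Qed.

(** The r-th root of the image length is of order s, and by [Hadapt] it grows at the rate [E]
    afterwards. The constant moves inside the power because [C2 >= 1]. *)
Lemma image_adapted (j : nat) (x y s : R) : U x -> U y -> 0 <= s ->
  Rabs (g x - g y) <= B * s ^ S r1 ->
  Rabs (iter g (S j) x - iter g (S j) y) <= (C2 * s * E ^ j) ^ S r1.
Proof.
  intros Ux Uy Hs0 Hxy. rewrite 2!iter_S_r.
  apply Rle_trans with (1 := Hadapt j _ _ (HgU _ Ux) (HgU _ Uy)).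
  assert (Hj := HEpow j).
  apply Rle_trans with (Cp * (E ^ j) ^ S r1 * (B * s ^ S r1)).
  { apply Rmult_le_compat_l; [|easy].
    apply Rmult_le_pos; [lra | apply pow_le; lra]. }
  replace (C2 * s * E ^ j) with (C2 * (E ^ j * s)) by ring.
  rewrite (Rpow_mult_distr C2), (Rpow_mult_distr (E ^ j)).
  replace (Cp * (E ^ j) ^ S r1 * (B * s ^ S r1))
    with (C2 * ((E ^ j) ^ S r1 * s ^ S r1)) by (unfold C2; ring).
  apply Rmult_le_compat_r; [| apply self_le_pow; [easy | lia]].
  apply Rmult_le_pos; apply pow_le; lra.
Qed.

Lemma terminal_single (t : nat) (u v : R) (Y : list R) :
  U u -> U v -> u <= v -> NoDup Y ->
  (forall y, In y Y -> u <= y <= v) -> good g eta (S t) Y ->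
  (forall z, u <= z <= v -> Rabs (g1 z) <= B * (v - u) ^ r1) ->
  C2 * (v - u) * E ^ t < eta -> (length Y <= 1)%nat.
Proof.
  intros Uu Uv Huv Hd Hin Hg HBs Hsm. assert (Ht := HEpow t).
  apply (good_single (S t) u v); auto. intros x y Hx Hy.
  apply Rle_trans with ((C2 * (v - u) * E ^ t) ^ S r1).
  - apply image_adapted; try (apply (Hconv u v); auto; fail); [lra|].
    apply Rle_trans with (1 := Hctr u v _ Uu Uv Huv HBs x y Hx Hy). simpl. right; ring.
  - apply Rle_trans with (C2 * (v - u) * E ^ t); [|lra].
    apply pow_le_self; [|lia]. split; [|lra].
    apply Rmult_le_pos; [|lra]. apply Rmult_le_pos; lra.
Qed.

(** A node is closed if it splits into monotone pieces or is too short to carry two points.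
    Otherwise it stays open and hands to its halves what they need: the floor for half the length,
    and a derivative bound in terms of twice their length. *)
Lemma node_alternative (t b : nat) (q u v : R) (Y : list R) :
  claim t -> (b <= N)%nat -> eta <= E * q * E ^ t ->
  U u -> U v -> u <= v -> v - u <= Delta -> NoDup Y ->
  (forall y, In y Y -> u <= y <= v) -> good g eta (S t) Y ->
  (forall y y', In y Y -> In y' Y -> forall j, (j < b)%nat ->
     Rabs (iter g (S j) y - iter g (S j) y') <= Delta) ->
  (forall x y, u <= x <= v -> u <= y <= v ->
     forall j, Rabs (iter g (S j) x - iter g (S j) y) <= (E * q * E ^ j) ^ S r1) ->
  (forall z, u <= z <= v -> Rabs (g1 z) <= sigma) ->
  (forall z, u <= z <= v -> Rabs (g1 z) <= B * (2 * (v - u)) ^ r1) ->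
  eta <= 2 * C2 * (v - u) * E ^ t ->
  wsum (w (S t)) Y <= (v - u) * node_bound t b q \/
  (eta <= C2 * (v - u) * E ^ t /\
   forall z, u <= z <= v -> Rabs (g1 z) <= B * (v - u) ^ r1).
Proof.
  intros Hcl Hb Hq Uu Uv Huv Hl Hd Hin Hg Htr Had Hs HBz Hfl.
  assert (HX1 : 1 <= core_bound t b (E * q)) by now apply core_bound_ge_1.
  assert (Hct := core_const_pos). assert (Ht := HEpow t).
  assert (HX2 : 0 <= slope).
  { unfold slope. apply Rcomplements.Rdiv_le_0_compat; [|lra]. nra. }
  assert (Hfac : 0 <= sigma * 4 ^ r1 * B ^ 2).
  { apply Rmult_le_pos; [apply Rmult_le_pos|]; lra. }
  assert (Hst : 0 <= slope * E ^ t) by (apply Rmult_le_pos; lra).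
  set (K := sigma * 4 ^ r1 * B ^ 2 * core_bound t b (E * q) + omega * (slope * E ^ t)).
  assert (HK : 0 <= K).
  { unfold K. assert (0 <= sigma * 4 ^ r1 * B ^ 2 * core_bound t b (E * q))
      by (apply Rmult_le_pos; lra).
    assert (0 <= omega * (slope * E ^ t)) by (apply Rmult_le_pos; lra). lra. }
  assert (Had2 : forall x y, u <= x <= v -> u <= y <= v -> forall j,
     Rabs (iter g (S j) x - iter g (S j) y) <= (2 * C2 * (v - u) * E ^ j) ^ S r1).
  { intros x y Hx Hy j.
    replace (2 * C2 * (v - u)) with (C2 * (2 * (v - u))) by ring.
    apply image_adapted; try (apply (Hconv u v); auto; fail); [lra|].
    apply Rle_trans with (1 := Hctr u v _ Uu Uv Huv HBz x y Hx Hy).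
    assert (0 <= (2 * (v - u)) ^ r1) by (apply pow_le; lra).
    simpl. assert (0 <= B * (2 * (v - u)) ^ r1) by nra. nra. }
  assert (Hleaf : forall Y', incl Y' Y ->
      wsum (fun y => w t (g y)) Y' <= core_bound t b (E * q) ->
      wsum (fun y => w t (g y)) Y' <= core_bound t b (2 * C2 * (v - u)) ->
      wsum (w (S t)) Y' <= (v - u) * K).
  { intros Y' Hi S1 S2.
    assert (S0 : 0 <= wsum (fun y => w t (g y)) Y')
      by (apply wsum_nonneg; intros; apply weight_bounds).
    assert (S3 := Rle_trans _ _ _ S2 (core_bound_linear t b (v - u))).
    apply Rle_trans with
      ((sigma * 4 ^ r1 * B ^ 2 * (v - u) + omega) * wsum (fun y => w t (g y)) Y').
    - rewrite <- wsum_scal. apply wsum_le. intros y Hy. unfold w. simpl.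
      apply Rmult_le_compat_r; [apply weight_bounds|].
      apply (node_weight u v); auto. lra.
    - set (S := wsum (fun y => w t (g y)) Y') in *. unfold K.
      assert (sigma * 4 ^ r1 * B ^ 2 * (v - u) * S
        <= sigma * 4 ^ r1 * B ^ 2 * (v - u) * core_bound t b (E * q)).
      { apply Rmult_le_compat_l; [|easy]. apply Rmult_le_pos; lra. }
      assert (omega * S <= omega * (slope * E ^ t * (v - u)))
        by (apply Rmult_le_compat_l; lra).
      lra. }
  destruct (Hsplit u v Uu Uv Huv ltac:(lra)) as [[T [HT [Hcov HTm]]]|HBs].
  - left. unfold node_bound. fold K.
    replace ((v - u) * (INR cr * K)) with (INR cr * ((v - u) * K)) by ring.
    apply Rle_trans with (INR (length T) * ((v - u) * K)).
    + apply wsum_cover with (P := fun p y => fst p <= y <= snd p); auto.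
      intros [u' v'] Hp Y' Hd' Hi' Hin'.
      destruct (HTm _ Hp) as [H1 [H2 [H3 H5]]]. cbn [fst snd] in H1, H2, H3, H5, Hin'.
      assert (Uu' : U u') by (apply (Hconv u v); auto; lra).
      assert (Uv' : U v') by (apply (Hconv u v); auto; lra).
      apply Hleaf; auto; apply (push_mono t b _ u' v'); auto; try lra;
        try (now apply good_incl with Y); try (intros x y Hx Hy; apply Htr; auto).
      * intros x y Hx Hy. apply Had; lra.
      * intros x y Hx Hy. apply Had2; lra.
    + apply Rmult_le_compat_r; [apply Rmult_le_pos; lra | now apply le_INR].
  - destruct (Rlt_dec (C2 * (v - u) * E ^ t) eta) as [Hsm|Hbig]; [left | right; split; [lra|easy]].
    assert (H1 : (length Y <= 1)%nat).
    { apply (terminal_single t u v); auto. }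
    assert (HY1 : wsum (fun y => w t (g y)) Y <= 1).
    { apply Rle_trans with (wsum (fun _ => 1) Y).
      - apply wsum_le. intros. apply weight_bounds.
      - rewrite wsum_const. apply le_INR in H1. simpl in H1. lra. }
    apply Rle_trans with ((v - u) * K).
    + apply Hleaf; [apply incl_refl | lra |].
      apply Rle_trans with (1 := HY1). now apply core_bound_ge_1.
    + unfold node_bound. fold K. apply Rmult_le_compat_l; [lra | nra].
Qed.

(* The bound is linear in the length of the interval, so it is stable under bisection. *)
Lemma bisection_tree (t b : nat) (q : R) :
  claim t -> (b <= N)%nat -> eta <= E * q * E ^ t ->
  forall n u v Y, U u -> U v -> u <= v -> v - u <= Delta -> NoDup Y ->
  (forall y, In y Y -> u <= y <= v) -> good g eta (S t) Y ->
  (forall y y', In y Y -> In y' Y -> forall j, (j < b)%nat ->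
     Rabs (iter g (S j) y - iter g (S j) y') <= Delta) ->
  (forall x y, u <= x <= v -> u <= y <= v ->
     forall j, Rabs (iter g (S j) x - iter g (S j) y) <= (E * q * E ^ j) ^ S r1) ->
  (forall z, u <= z <= v -> Rabs (g1 z) <= sigma) ->
  (forall z, u <= z <= v -> Rabs (g1 z) <= B * (2 * (v - u)) ^ r1) ->
  eta <= 2 * C2 * (v - u) * E ^ t ->
  2 * C2 * (v - u) * E ^ t <= eta * 2 ^ n ->
  wsum (w (S t)) Y <= (v - u) * node_bound t b q.
Proof.
  intros Hcl Hb Hq.
  induction n as [|n IH]; intros u v Y Uu Uv Huv Hl Hd Hin Hg Htr Had Hs HBz Hfl Hn;
  destruct (node_alternative t b q u v Y Hcl Hb Hq Uu Uv Huv Hl Hd Hin Hg Htr Had Hs HBz Hfl)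
    as [H|[Hbig HBs]]; auto.
  (* The depth [n] is fuel: an open node satisfies the floor with a factor 2 to spare, which is
     impossible when [n = 0]. *)
  - simpl in Hn. exfalso. lra.
  - set (m := (u + v) / 2). assert (Hm : u <= m <= v) by (unfold m; lra).
    assert (Um : U m) by now apply (Hconv u v).
    rewrite (wsum_split _ (fun y => if Rle_dec y m then true else false)).
    assert (Hh : forall u' v' Y', U u' -> U v' -> u <= u' -> v' <= v -> v' - u' = (v - u) / 2 ->
       incl Y' Y -> NoDup Y' -> (forall y, In y Y' -> u' <= y <= v') ->
       wsum (w (S t)) Y' <= (v - u) / 2 * node_bound t b q).
    { intros u' v' Y' Uu' Uv' H1 H2 H3 Hi Hd' Hin'. rewrite <- H3.
      apply IH; auto; try lra.
      - now apply good_incl with Y.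
      - intros x y Hx Hy. apply Had; lra.
      - intros z Hz. apply Hs. lra.
      - intros z Hz. rewrite H3. replace (2 * ((v - u) / 2)) with (v - u) by field.
        apply HBs. lra.
      - rewrite H3. lra.
      - rewrite H3. simpl in Hn. lra. }
    assert (K1 : wsum (w (S t)) (filter (fun y => if Rle_dec y m then true else false) Y)
        <= (v - u) / 2 * node_bound t b q).
    { apply (Hh u m); auto; try (unfold m; lra).
      - apply incl_filter.
      - now apply NoDup_filter.
      - intros y Hy. apply filter_In in Hy as [Hy Hy2]. specialize (Hin y Hy).
        destruct Rle_dec; [lra | easy]. }
    assert (K2 : wsum (w (S t)) (filter (fun y => negb (if Rle_dec y m then true else false)) Y)
        <= (v - u) / 2 * node_bound t b q).
    { apply (Hh m v); auto; try (unfold m; lra).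
      - apply (incl_filter (fun y => negb _)).
      - now apply NoDup_filter.
      - intros y Hy. apply filter_In in Hy as [Hy Hy2]. specialize (Hin y Hy).
        destruct Rle_dec; [easy | lra]. }
    lra.
Qed.

(** For b > 0 this is an equality: the factor [E] released by one step multiplies both terms of the
    minimum. For b = 0 the counter cannot decrease, and q <= Delta makes q / Delta the smaller
    term. *)
Lemma core_bound_step (t b : nat) (q : R) : (b = 0%nat -> q <= Delta) ->
  core_bound t (pred b) (E * q) <= core_bound (S t) b q.
Proof.
  intros Hb. unfold core_bound. assert (Hc := core_const_pos). assert (Ht := HEpow t).
  rewrite 2!Rmult_assoc. apply Rmult_le_compat_l; [lra|].
  replace (E ^ S t) with (E ^ t * E) by (simpl; ring). rewrite Rmult_assoc.
  apply Rmult_le_compat_l; [lra|].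
  rewrite (Rmult_comm E (Rmin _ _)), Rmult_min_distr_r by lra.
  replace (q / Delta * E) with (E * q / Delta) by (field; lra).
  destruct b as [|b].
  - simpl. rewrite Rinv_1, Rmult_1_l. apply Rle_trans with (1 := Rmin_r _ _).
    apply Rmin_glb; [|lra]. apply Rle_div_l; [lra|].
    specialize (Hb eq_refl). nra.
  - right. f_equal. simpl. specialize (HEpow b). field. lra.
Qed.

(** The smallness of [sigma] brings the first summand below a quarter of the target, that of [omega]
    the second below a half. For the latter, the minimum in [core_bound] is at least x / E^N,
    because b <= N and x <= q; hence the factor E^N in [Homega1]. *)
Lemma node_bound_step (t b : nat) (q x : R) : (b = 0%nat -> q <= Delta) -> (b <= N)%nat ->
  eta <= q * E ^ S t -> 0 <= x <= 1 -> x <= q ->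
  x * node_bound t (pred b) q <= core_bound (S t) b q.
Proof.
  intros Hb HbN Hq Hx Hxq. assert (Hs := core_bound_step t b q Hb).
  assert (Hc := core_const_pos). assert (Ht := HEpow t). assert (HNp := HEpow N).
  assert (HX : 1 <= core_bound t (pred b) (E * q)).
  { apply core_bound_ge_1; [lia|]. simpl in Hq. lra. }
  unfold node_bound. set (X := core_bound t (pred b) (E * q)) in *.
  assert (P1 : INR cr * (sigma * 4 ^ r1 * B ^ 2 * X) * x <= core_bound (S t) b q / 4).
  { replace (INR cr * (sigma * 4 ^ r1 * B ^ 2 * X))
      with (4 * INR cr * 4 ^ r1 * B ^ 2 * sigma * (X / 4)) by field.
    assert (0 <= 4 * INR cr * 4 ^ r1 * B ^ 2 * sigma).
    { repeat apply Rmult_le_pos; lra. }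
    assert (4 * INR cr * 4 ^ r1 * B ^ 2 * sigma * (X / 4) <= X / 4) by nra.
    assert (0 <= 4 * INR cr * 4 ^ r1 * B ^ 2 * sigma * (X / 4)) by nra. nra. }
  assert (P2 : INR cr * (omega * (slope * E ^ t)) * x <= core_bound (S t) b q / 2).
  { assert (Hm : x * / E ^ N <= Rmin (/ E ^ b) (q / Delta)).
    { assert (Hi : 0 < / E ^ N <= 1).
      { split; [apply Rinv_0_lt_compat; lra|].
        rewrite <- Rinv_1. apply Rinv_le_contravar; lra. }
      apply Rmin_glb.
      - assert (/ E ^ N <= / E ^ b).
        { apply Rinv_le_contravar; [specialize (HEpow b); lra|]. now apply Rle_pow. }
        nra.
      - assert (x * / E ^ N <= x) by nra.
        assert (0 <= x * / E ^ N) by nra.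
        apply (Rle_div_r (x * / E ^ N) q Delta); [lra|].
        apply Rle_trans with (x * / E ^ N * 1); [|lra].
        apply Rmult_le_compat_l; lra. }
    assert (Hw : 4 * INR cr * C2 * omega / Delta <= / E ^ N).
    { apply Rle_div_l; [lra|]. apply Rmult_le_reg_l with (E ^ N); [lra|].
      replace (E ^ N * (/ E ^ N * Delta)) with Delta by (field; lra).
      unfold C2. lra. }
    replace (INR cr * (omega * (slope * E ^ t)) * x)
      with (core_const * E ^ t / 2 * (4 * INR cr * C2 * omega / Delta * x))
      by (unfold slope; field; lra).
    assert (Hw2 : 4 * INR cr * C2 * omega / Delta * x <= Rmin (/ E ^ b) (q / Delta)).
    { apply Rle_trans with (2 := Hm). rewrite Rmult_comm. apply Rmult_le_compat_l; lra. }
    assert (Hnn : 0 <= 4 * INR cr * C2 * omega / Delta * x).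
    { apply Rmult_le_pos; [|lra]. apply Rcomplements.Rdiv_le_0_compat; [|lra].
      repeat apply Rmult_le_pos; lra. }
    unfold core_bound. replace (E ^ S t) with (E ^ t * E) by (simpl; ring).
    set (M := Rmin (/ E ^ b) (q / Delta)) in *.
    assert (core_const * E ^ t / 2 * (4 * INR cr * C2 * omega / Delta * x)
      <= core_const * E ^ t / 2 * (E * M)).
    { apply Rmult_le_compat_l; nra. }
    lra. }
  lra.
Qed.

(** Three cases below the scale [Delta]. A monotone interval is pushed forward without loss. A
    critical one with few monotone pieces is paid for by [INR cr * (sigma + omega) <= 1]. A flat
    critical one goes to the bisection. *)
Lemma small_step (t b : nat) (q lo hi : R) (Y : list R) :
  claim t -> state (S t) b q lo hi Y -> hi - lo <= Delta -> (b = 0%nat -> q <= Delta) ->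
  wsum (w (S t)) Y <= core_bound (S t) b q.
Proof.
  intros Hcl [Ulo Uhi Hle Hlen Hd Hin Hg Hb Htr Hq Had] Hl Hbq.
  assert (Hct := core_const_pos). assert (Ht := HEpow t).
  assert (Htr' : forall y y', In y Y -> In y' Y -> forall j, (j < pred b)%nat ->
     Rabs (iter g (S j) y - iter g (S j) y') <= Delta).
  { intros y y' Hy Hy' j Hj. apply Htr; auto. lia. }
  assert (Had' : forall x y, lo <= x <= hi -> lo <= y <= hi ->
     forall j, Rabs (iter g (S j) x - iter g (S j) y) <= (E * q * E ^ j) ^ S r1).
  { intros x y Hx Hy j. replace (E * q * E ^ j) with (q * E ^ S j) by (simpl; ring).
    now apply Had. }
  assert (Hq' : eta <= E * q * E ^ t).
  { simpl in Hq. lra. }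
  assert (Hstep := core_bound_step t b q Hbq).
  assert (HX : 1 <= core_bound t (pred b) (E * q)) by (apply core_bound_ge_1; [lia | easy]).
  destruct (Hreg lo hi Ulo Uhi Hle Hl) as [Hm|Hs].
  { apply Rle_trans with (2 := Hstep).
    apply Rle_trans with (wsum (fun y => w t (g y)) Y).
    - apply wsum_le. intros y Hy. unfold w. simpl.
      assert (H1 := phi_bounds (g1 y)). assert (H2 := weight_bounds t (g y)).
      unfold w in H2. nra.
    - apply (push_mono t (pred b) (E * q) lo hi); auto. lia. }
  destruct (Hsplit lo hi Ulo Uhi Hle Hlen) as [[T [HT [Hcov HTm]]]|HBs].
  { apply Rle_trans with (INR (length T) * ((sigma + omega) * core_bound t (pred b) (E * q))).
    - apply wsum_cover with (P := fun p y => fst p <= y <= snd p); auto.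
      intros [u' v'] Hp Y' Hd' Hi' Hin'.
      destruct (HTm _ Hp) as [H1 [H2 [H3 H5]]]. cbn [fst snd] in H1, H2, H3, H5, Hin'.
      assert (Uu' : U u') by (apply (Hconv lo hi); auto; lra).
      assert (Uv' : U v') by (apply (Hconv lo hi); auto; lra).
      apply Rle_trans with ((sigma + omega) * wsum (fun y => w t (g y)) Y').
      + rewrite <- wsum_scal. apply wsum_le. intros y Hy. unfold w. simpl.
        apply Rmult_le_compat_r; [apply weight_bounds|].
        assert (Hsy := Hs y (Hin y (Hi' y Hy))).
        apply Rle_trans with (1 := phi_small _ Hsy). apply Rplus_le_compat_r.
        assert (H0 := Rabs_pos (g1 y)).
        assert (Rabs (g1 y) ^ 2 <= 1) by (simpl; nra). nra.
      + apply Rmult_le_compat_l; [lra|].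
        apply (push_mono t (pred b) _ u' v'); auto; try lra; try lia.
        * now apply good_incl with Y.
        * intros x y Hx Hy. apply Had'; lra.
    - apply Rle_trans with (2 := Hstep).
      apply le_INR in HT.
      assert (INR (length T) * (sigma + omega) <= 1) by nra.
      rewrite <- Rmult_assoc. nra. }
  destruct (Rlt_dec (2 * C2 * (hi - lo) * E ^ t) eta) as [Hsm|Hbig].
  { assert (H1 : (length Y <= 1)%nat).
    { apply (terminal_single t lo hi); auto.
      assert (0 <= C2 * (hi - lo) * E ^ t).
      { apply Rmult_le_pos; [|lra]. apply Rmult_le_pos; lra. }
      lra. }
    apply Rle_trans with 1; [|lra].
    apply Rle_trans with (wsum (fun _ => 1) Y).
    - apply wsum_le. intros. apply weight_bounds.
    - rewrite wsum_const. apply le_INR in H1. simpl in H1. lra. }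
  apply Rle_trans with ((hi - lo) * node_bound t (pred b) q).
  - destruct (Pow_x_infinity 2) with (b := 2 * C2 * (hi - lo) * E ^ t / eta) as [n Hn].
    { rewrite Rabs_pos_eq; lra. }
    specialize (Hn n (Nat.le_refl n)).
    rewrite Rabs_pos_eq in Hn by (apply pow_le; lra).
    apply Rge_le, Rle_div_l in Hn; [|lra].
    apply (bisection_tree t (pred b) q Hcl ltac:(lia) Hq' n); auto; try lra.
    intros z Hz. apply Rle_trans with (1 := HBs z Hz).
    apply Rmult_le_compat_l; [lra|]. apply pow_incr. lra.
  - apply node_bound_step; auto; [lra|].
    (* At time 0 the size gives hi - lo <= q^r, hence hi - lo <= q if q <= 1; for larger q the bound
       1 on the length suffices. *)
    assert (H := Had hi lo ltac:(lra) ltac:(lra) 0%nat). simpl iter in H.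
    rewrite Rabs_pos_eq, pow_O, Rmult_1_r in H by lra.
    destruct (Rle_dec 1 q); [lra|].
    apply Rle_trans with (1 := H). apply pow_le_self; [|lia].
    assert (0 < E ^ S t) by (specialize (HEpow (S t)); lra). split; nra.
Qed.

(** Tracking controls the points and not the interval, which is therefore first shrunk to the hull
    of [Y]. *)
Lemma tracked_step (t b : nat) (q lo hi : R) (Y : list R) :
  claim t -> state (S t) b q lo hi Y -> (1 <= b)%nat ->
  wsum (w (S t)) Y <= core_bound (S t) b q.
Proof.
  intros Hcl [Ulo Uhi Hle Hlen Hd Hin Hg Hb Htr Hq Had] Hb1.
  assert (Y = nil \/ Y <> nil) as [->|HY] by (destruct Y; [now left | now right]).
  { simpl. apply Rle_trans with 1; [lra | now apply core_bound_ge_1]. }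
  destruct (list_Rmin Y HY) as [a [Ha Ha1]]. destruct (list_Rmax Y HY) as [c [Hc Hc1]].
  assert (Ia := Hin a Ha). assert (Ic := Hin c Hc). assert (Hac := Ha1 c Hc).
  assert (Hac2 := Htr a c Ha Hc 0%nat ltac:(lia)). simpl in Hac2.
  rewrite Rabs_left1 in Hac2 by lra.
  apply (small_step t b q a c); auto; [|lra|lia].
  split; auto.
  - now apply (Hconv lo hi).
  - now apply (Hconv lo hi).
  - lra.
  - intros x y Hx Hy. apply Had; lra.
Qed.

Lemma core_claim (t : nat) : claim t.
Proof.
  induction t as [|t IH]; intros b q lo hi Y Hst.
  - destruct Hst as [Ulo Uhi Hle Hlen Hd Hin Hg Hb Htr Hq Had].
    apply Rle_trans with (/ eta + 1); [|now apply core_bound_ge].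
    unfold w. simpl. rewrite wsum_const, Rmult_1_l.
    apply Rle_trans with ((hi - lo) / eta + 1).
    + apply count_separated; auto; [lra|].
      assert (Hw : forall x y, In x Y -> In y Y -> x < y -> eta <= y - x).
      { intros x y Hx Hy Hxy. destruct (Hg x y Hx Hy Hxy) as [u [v [Hu [Hv H]]]].
        simpl in H. revert H. unfold Rabs. destruct Rcase_abs; lra. }
      intros x y Hx Hy Hxy. destruct (Rtotal_order x y) as [H|[H|H]]; [|easy|].
      * rewrite Rabs_left by lra. specialize (Hw x y Hx Hy H). lra.
      * rewrite Rabs_right by lra. specialize (Hw y x Hy Hx H). lra.
    + apply Rplus_le_compat_r. unfold Rdiv. rewrite <- (Rmult_1_l (/ eta)) at 2.
      apply Rmult_le_compat_r; [|easy]. left. apply Rinv_0_lt_compat. lra.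
  - destruct (Nat.eq_dec b 0) as [->|Hb0].
    2:{ apply (tracked_step t b q lo hi); auto. lia. }
    assert (Hst' := Hst). destruct Hst' as [Ulo Uhi Hle Hlen Hd Hin Hg Hb Htr Hq Had].
    assert (HEt := HEpow (S t)). assert (Hct := core_const_pos). assert (HENp := HEpow N).
    assert (Hq0 : 0 < q) by nra.
    destruct (Rle_dec q Delta) as [Hqd|Hqd].
    + apply (small_step t 0 q lo hi); auto.
      assert (H := Had hi lo ltac:(lra) ltac:(lra) 0%nat). simpl iter in H.
      rewrite Rabs_pos_eq, pow_O, Rmult_1_r in H by lra.
      apply Rle_trans with (1 := H), Rle_trans with (2 := Hqd).
      apply pow_le_self; [lra | lia].
    (* Each of the at most E^N balls starts with b = N and is bounded by the term E^(-N) of the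
       minimum, so the cover is free. It takes no time, hence one tracked step is made before the
       induction hypothesis is used. *)
    + destruct (Hcover lo hi Ulo Uhi Hle Hlen) as [T [HT [Hcov HTr]]].
      apply Rle_trans with (INR (length T) * (core_const * E ^ S t * / E ^ N)).
      * apply wsum_cover with (P := fun (P : R -> Prop) y => P y); auto.
        intros P HP Y' Hd' Hi' Hin'.
        apply Rle_trans with (core_bound (S t) N q).
        -- apply (tracked_step t N q lo hi); auto.
           split; auto.
           ++ now apply good_incl with Y.
           ++ intros y y' Hy Hy' j Hj. apply (HTr P HP); auto.
        -- unfold core_bound. apply Rmult_le_compat_l; [nra | apply Rmin_l].
      * unfold core_bound. rewrite pow_O, Rinv_1, Rmin_left.
        2:{ apply Rle_div_r; lra. }
        rewrite Rmult_1_r, <- Rmult_assoc, (Rmult_comm (INR _)), Rmult_assoc.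
        rewrite <- (Rmult_1_r (core_const * E ^ S t)) at 2.
        apply Rmult_le_compat_l; [nra|].
        apply Rmult_le_reg_r with (E ^ N); [lra|].
        rewrite Rmult_assoc, Rinv_l; lra.
Qed.

End Core.

(** * Derivatives within a convex set *)

Definition convex_set (U : R -> Prop) : Prop := forall x y z, U x -> U y -> x <= z <= y -> U z.

Definition no_isolated_point (U : R -> Prop) : Prop := forall x, U x -> forall d, 0 < d ->
  exists y, U y /\ y <> x /\ Rabs (y - x) < d.

Lemma has_deriv_within_linear U g x L : has_deriv_within U g x L -> forall eps, 0 < eps ->
  exists d, 0 < d /\ forall y, U y -> Rabs (y - x) < d ->
    Rabs (g y - g x - L * (y - x)) <= eps * Rabs (y - x).
Proof.
  intros H eps He. destruct (H eps He) as [d [Hd H1]]. exists d. split; [easy|].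
  intros y Uy Hy. destruct (Req_dec y x) as [->|Hn].
  - replace (g x - g x - L * (x - x)) with 0 by ring.
    rewrite Rminus_diag, Rabs_R0. lra.
  - specialize (H1 y Uy Hn Hy).
    replace (g y - g x - L * (y - x)) with (((g y - g x) / (y - x) - L) * (y - x))
      by (field; lra).
    rewrite Rabs_mult. apply Rmult_le_compat_r; [apply Rabs_pos | lra].
Qed.

Lemma linear_has_deriv_within U g x L : (forall eps, 0 < eps ->
  exists d, 0 < d /\ forall y, U y -> Rabs (y - x) < d ->
    Rabs (g y - g x - L * (y - x)) <= eps * Rabs (y - x)) -> has_deriv_within U g x L.
Proof.
  intros H eps He. destruct (H (eps / 2)) as [d [Hd H1]]; [lra|].
  exists d. split; [easy|]. intros y Uy Hn Hy. specialize (H1 y Uy Hy).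
  replace ((g y - g x) / (y - x) - L) with ((g y - g x - L * (y - x)) / (y - x))
    by (field; lra).
  assert (0 < Rabs (y - x)) by (apply Rabs_pos_lt; lra).
  rewrite Rabs_div by lra. apply Rlt_div_l; [easy|]. nra.
Qed.

Lemma has_deriv_within_unique U g x L L' : no_isolated_point U -> U x ->
  has_deriv_within U g x L -> has_deriv_within U g x L' -> L = L'.
Proof.
  intros Ha Ux H H'. destruct (Req_dec L L') as [|Hn]; [easy|]. exfalso.
  assert (He : 0 < Rabs (L - L') / 2).
  { assert (0 < Rabs (L - L')) by (apply Rabs_pos_lt; lra). lra. }
  destruct (H _ He) as [d [Hd H1]]. destruct (H' _ He) as [d' [Hd' H2]].
  destruct (Ha x Ux (Rmin d d')) as [y [Uy [Hy Hy2]]]; [now apply Rmin_pos|].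
  assert (K := Rmin_l d d'). assert (K' := Rmin_r d d').
  specialize (H1 y Uy Hy ltac:(lra)). specialize (H2 y Uy Hy ltac:(lra)).
  set (q := (g y - g x) / (y - x)) in *.
  assert (Rabs (L - L') <= Rabs (q - L) + Rabs (q - L')).
  { replace (L - L') with (- (q - L) + (q - L')) by ring.
    rewrite <- (Rabs_Ropp (q - L)). apply Rabs_triang. }
  lra.
Qed.

Lemma has_deriv_within_ext U g h x L : U x -> (forall y, U y -> g y = h y) ->
  has_deriv_within U g x L -> has_deriv_within U h x L.
Proof.
  intros Ux He H eps Hp. destruct (H eps Hp) as [d [Hd H1]]. exists d. split; [easy|].
  intros y Uy Hn Hy. rewrite <- !He by easy. now apply H1.
Qed.

Lemma has_deriv_within_cont U g x L : has_deriv_within U g x L -> forall eps, 0 < eps ->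
  exists d, 0 < d /\ forall y, U y -> Rabs (y - x) < d -> Rabs (g y - g x) < eps.
Proof.
  intros H eps He. destruct (has_deriv_within_linear U g x L H 1) as [d [Hd H1]]; [lra|].
  assert (HL := Rabs_pos L).
  exists (Rmin d (eps / (Rabs L + 2))). split.
  { apply Rmin_pos; [easy|]. apply Rdiv_lt_0_compat; lra. }
  intros y Uy Hy. assert (K := Rmin_l d (eps / (Rabs L + 2))).
  assert (K' := Rmin_r d (eps / (Rabs L + 2))).
  specialize (H1 y Uy ltac:(lra)).
  assert (Hy2 : Rabs (y - x) < eps / (Rabs L + 2)) by lra.
  apply Rlt_div_r in Hy2; [|lra].
  assert (Rabs (g y - g x) <= Rabs (g y - g x - L * (y - x)) + Rabs (L * (y - x))).
  { replace (g y - g x) with ((g y - g x - L * (y - x)) + L * (y - x)) at 1 by ring.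
    apply Rabs_triang. }
  rewrite Rabs_mult in H0. assert (H2 := Rabs_pos (y - x)). nra.
Qed.

Lemma has_deriv_within_comp U f g x L M : (forall y, U y -> U (g y)) -> U x ->
  has_deriv_within U g x L -> has_deriv_within U f (g x) M ->
  has_deriv_within U (fun y => f (g y)) x (M * L).
Proof.
  intros HU Ux Hg Hf. apply linear_has_deriv_within. intros eps He.
  assert (HL := Rabs_pos L). assert (HM := Rabs_pos M).
  set (e1 := eps / (2 * (Rabs L + 1))). set (e2 := Rmin 1 (eps / (2 * (Rabs M + 1)))).
  assert (He1 : 0 < e1) by (apply Rdiv_lt_0_compat; lra).
  assert (He2 : 0 < e2) by (apply Rmin_pos; [lra | apply Rdiv_lt_0_compat; lra]).
  destruct (has_deriv_within_linear _ _ _ _ Hf e1 He1) as [d1 [Hd1 H1]].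
  destruct (has_deriv_within_linear _ _ _ _ Hg e2 He2) as [d2 [Hd2 H2]].
  destruct (has_deriv_within_cont _ _ _ _ Hg d1 Hd1) as [d3 [Hd3 H3]].
  exists (Rmin d2 d3). split; [now apply Rmin_pos|].
  intros y Uy Hy. assert (K := Rmin_l d2 d3). assert (K' := Rmin_r d2 d3).
  specialize (H2 y Uy ltac:(lra)). specialize (H3 y Uy ltac:(lra)).
  specialize (H1 (g y) (HU y Uy) H3).
  assert (Hy0 := Rabs_pos (y - x)).
  assert (He21 : e2 <= 1) by apply Rmin_l.
  assert (Hgy : Rabs (g y - g x) <= (Rabs L + 1) * Rabs (y - x)).
  { replace (g y - g x) with ((g y - g x - L * (y - x)) + L * (y - x)) by ring.
    apply Rle_trans with (1 := Rabs_triang _ _). rewrite Rabs_mult. nra. }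
  replace (f (g y) - f (g x) - M * L * (y - x))
    with ((f (g y) - f (g x) - M * (g y - g x)) + M * (g y - g x - L * (y - x))) by ring.
  apply Rle_trans with (1 := Rabs_triang _ _). rewrite Rabs_mult.
  assert (E1 : e1 * ((Rabs L + 1) * Rabs (y - x)) = eps / 2 * Rabs (y - x)).
  { unfold e1. field. lra. }
  assert (E2 : Rabs M * e2 <= eps / 2).
  { apply Rle_trans with ((Rabs M + 1) * e2); [nra|].
    apply Rle_trans with ((Rabs M + 1) * (eps / (2 * (Rabs M + 1)))).
    - apply Rmult_le_compat_l; [lra | apply Rmin_r].
    - right. field. lra. }
  assert (e1 * Rabs (g y - g x) <= eps / 2 * Rabs (y - x)).
  { rewrite <- E1. apply Rmult_le_compat_l; lra. }
  assert (Rabs M * Rabs (g y - g x - L * (y - x)) <= eps / 2 * Rabs (y - x)).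
  { apply Rle_trans with (Rabs M * (e2 * Rabs (y - x))); [now apply Rmult_le_compat_l|].
    rewrite <- Rmult_assoc. now apply Rmult_le_compat_r. }
  lra.
Qed.

(** Composition with this retraction turns a function continuous within a convex set into one
    continuous on the whole line, to which the classical intermediate and mean value theorems
    apply. *)
Definition clamp (u v x : R) : R := Rmax u (Rmin v x).

Lemma clamp_in u v x : u <= v -> u <= clamp u v x <= v.
Proof.
  intros H. unfold clamp, Rmax, Rmin. destruct (Rle_dec v x), Rle_dec; lra.
Qed.

Lemma clamp_id u v x : u <= x <= v -> clamp u v x = x.
Proof.
  intros H. unfold clamp, Rmax, Rmin. destruct (Rle_dec v x), Rle_dec; lra.
Qed.

Lemma clamp_lip u v x y : u <= v -> Rabs (clamp u v x - clamp u v y) <= Rabs (x - y).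
Proof.
  intros H. unfold clamp, Rmax, Rmin.
  destruct (Rle_dec v x), (Rle_dec v y); repeat destruct Rle_dec;
  unfold Rabs; repeat destruct Rcase_abs; lra.
Qed.

Lemma clamp_continuous U h u v : convex_set U -> U u -> U v -> u <= v -> cont_within U h ->
  forall x, continuity_pt (fun x => h (clamp u v x)) x.
Proof.
  intros Hc Uu Uv Huv Hh x eps He.
  assert (HU : forall y, U (clamp u v y)).
  { intros y. apply (Hc u v); auto. now apply clamp_in. }
  destruct (Hh (clamp u v x) (HU x) eps He) as [d [Hd H]].
  exists d. split; [easy|]. intros y [_ Hy]. simpl in *. unfold R_dist, Rdist in *.
  apply H; [apply HU|]. apply Rle_lt_trans with (2 := Hy). now apply clamp_lip.
Qed.

Lemma cont_within_IVT U h u v c : convex_set U -> cont_within U h -> U u -> U v -> u <= v ->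
  Rmin (h u) (h v) <= c <= Rmax (h u) (h v) -> exists x, u <= x <= v /\ h x = c.
Proof.
  intros Hc Hh Uu Uv Huv Hb.
  destruct (IVT_gen (fun x => h (clamp u v x)) u v c) as [x [Hx Hxc]].
  - intros x. now apply (clamp_continuous U).
  - rewrite 2!clamp_id by lra. easy.
  - rewrite Rmin_left, Rmax_right in Hx by lra. rewrite clamp_id in Hxc by lra. now exists x.
Qed.

Lemma within_MVT U h h1 u v : convex_set U -> U u -> U v -> u <= v ->
  (forall x, U x -> has_deriv_within U h x (h1 x)) ->
  exists c, u <= c <= v /\ h v - h u = h1 c * (v - u).
Proof.
  intros Hc Uu Uv Huv Hd.
  assert (Hh : cont_within U h).
  { intros x Ux. now apply has_deriv_within_cont with (h1 x), Hd. }
  destruct (MVT_gen (fun x => h (clamp u v x)) u v h1) as [c [Hcc H]].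
  - rewrite Rmin_left, Rmax_right by lra. intros x Hx.
    apply is_derive_Reals. intros eps He.
    assert (Ux : U x) by (apply (Hc u v); auto; lra).
    destruct (Hd x Ux eps He) as [d [Hdp H]].
    assert (Hm : 0 < Rmin d (Rmin (x - u) (v - x))).
    { apply Rmin_pos; [easy|]. apply Rmin_pos; lra. }
    exists (mkposreal _ Hm). intros k Hk Hkd. simpl in Hkd.
    assert (K1 := Rmin_l d (Rmin (x - u) (v - x))).
    assert (K2 := Rmin_r d (Rmin (x - u) (v - x))).
    assert (K3 := Rmin_l (x - u) (v - x)). assert (K4 := Rmin_r (x - u) (v - x)).
    assert (Hkb : u <= x + k <= v).
    { revert Hkd. unfold Rabs. destruct Rcase_abs; lra. }
    rewrite 2!clamp_id by lra. specialize (H (x + k)).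
    replace (x + k - x) with k in H by ring. apply H; try lra.
    now apply (Hc u v).
  - intros x _. now apply (clamp_continuous U).
  - rewrite Rmin_left, Rmax_right in Hcc by lra. rewrite 2!clamp_id in H by lra.
    now exists c.
Qed.

Lemma within_contraction U h h1 m u v : convex_set U -> U u -> U v -> u <= v ->
  (forall x, U x -> has_deriv_within U h x (h1 x)) ->
  (forall z, u <= z <= v -> Rabs (h1 z) <= m) ->
  forall x y, u <= x <= v -> u <= y <= v -> Rabs (h x - h y) <= m * Rabs (x - y).
Proof.
  intros Hc Uu Uv Huv Hd Hm.
  assert (Hw : forall x y, u <= x -> x <= y -> y <= v -> Rabs (h y - h x) <= m * (y - x)).
  { intros x y H1 H2 H3.
    destruct (within_MVT U h h1 x y Hc) as [c [Hcc ->]]; auto.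
    - apply (Hc u v); auto; lra.
    - apply (Hc u v); auto; lra.
    - rewrite Rabs_mult, (Rabs_pos_eq (y - x)) by lra.
      apply Rmult_le_compat_r; [lra | apply Hm; lra]. }
  intros x y Hx Hy. destruct (Rle_dec x y) as [Hxy|Hxy].
  - rewrite Rabs_minus_sym, (Rabs_left1 (x - y)) by lra.
    replace (- (x - y)) with (y - x) by ring. apply Hw; lra.
  - rewrite (Rabs_pos_eq (x - y)) by lra. apply Hw; lra.
Qed.

Definition const_sign (h : R -> R) (u v : R) : Prop :=
  (forall z, u <= z <= v -> 0 <= h z) \/ (forall z, u <= z <= v -> h z <= 0).

Definition split_sign (h : R -> R) (c : nat) (u v : R) : Prop :=
  exists T : list (R * R), (length T <= c)%nat /\
    (forall x, u <= x <= v -> exists p, In p T /\ fst p <= x <= snd p) /\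
    (forall p, In p T ->
       u <= fst p /\ fst p <= snd p /\ snd p <= v /\ const_sign h (fst p) (snd p)).

Lemma const_sign_mono U h h1 u v : convex_set U -> U u -> U v -> u <= v ->
  (forall x, U x -> has_deriv_within U h x (h1 x)) -> const_sign h1 u v -> mono h u v.
Proof.
  intros Hc Uu Uv Huv Hd [Hs|Hs]; [left | right]; intros x y H1 H2 H3;
  destruct (within_MVT U h h1 x y Hc) as [c [Hcc He]]; auto;
  try (apply (Hc u v); auto; lra); specialize (Hs c ltac:(lra)); nra.
Qed.

(** One cut at a zero suffices for a monotone function; without a zero the sign is constant by the
    intermediate value theorem. *)
Lemma mono_split_sign U h u v : convex_set U -> cont_within U h -> U u -> U v -> u <= v ->
  mono h u v -> split_sign h 2 u v.
Proof.
  intros Hc Hh Uu Uv Huv Hm.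
  destruct (classic (exists z, u <= z <= v /\ h z = 0)) as [[z [Hz Hz0]]|Hn].
  - exists ((u, z) :: (z, v) :: nil). split; [simpl; lia|]. split.
    + intros x Hx. destruct (Rle_dec x z).
      * exists (u, z). simpl. split; [now left | lra].
      * exists (z, v). simpl. split; [right; now left | lra].
    + intros p [<-|[<-|[]]]; cbn [fst snd]; repeat split; try lra;
      destruct Hm as [Hm|Hm].
      * right. intros x Hx. rewrite <- Hz0. apply Hm; lra.
      * left. intros x Hx. rewrite <- Hz0. apply Hm; lra.
      * left. intros x Hx. rewrite <- Hz0. apply Hm; lra.
      * right. intros x Hx. rewrite <- Hz0. apply Hm; lra.
  - exists ((u, v) :: nil). split; [simpl; lia|]. split.
    + intros x Hx. exists (u, v). split; [now left | easy].
    + intros p [<-|[]]. cbn [fst snd]. repeat split; try lra.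
      destruct (Rle_dec 0 (h u)) as [Hu|Hu]; [left | right]; intros z Hz;
      apply Rnot_lt_le; intros Hlt; apply Hn;
      (destruct (cont_within_IVT U h u z 0) as [x [Hx Hx0]]; auto;
       [ apply (Hc u v); auto; lra | lra
       | split; [apply Rle_trans with (Rmin (h u) (h z)); [lra|] |];
         unfold Rmin, Rmax; repeat destruct Rle_dec; lra
       | exists x; split; [lra | easy] ]).
Qed.

Lemma split_sign_refine h (c : nat) u v (T : list (R * R)) :
  (forall x, u <= x <= v -> exists p, In p T /\ fst p <= x <= snd p) ->
  (forall p, In p T -> u <= fst p /\ fst p <= snd p /\ snd p <= v) ->
  (forall p, In p T -> split_sign h c (fst p) (snd p)) ->
  split_sign h (length T * c) u v.
Proof.
  intros Hcov Hb Hs.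
  assert (K : exists T', (length T' <= length T * c)%nat /\
    (forall p x, In p T -> fst p <= x <= snd p -> exists p', In p' T' /\ fst p' <= x <= snd p') /\
    (forall p', In p' T' ->
       u <= fst p' /\ fst p' <= snd p' /\ snd p' <= v /\ const_sign h (fst p') (snd p'))).
  { clear Hcov. induction T as [|p T IH].
    - exists nil. repeat split; try easy. 
    - destruct IH as [T' [H1 [H2 H3]]].
      { intros; apply Hb; now right. }
      { intros; apply Hs; now right. }
      destruct (Hs p (or_introl eq_refl)) as [T2 [L1 [L2 L3]]].
      destruct (Hb p (or_introl eq_refl)) as [B1 [B2 B3]].
      exists (T2 ++ T'). split; [rewrite length_app; simpl; lia|]. split.
      + intros p0 x [<-|Hp0] Hx.
        * destruct (L2 x Hx) as [p' [Hp' Hx']]. exists p'. split; [|easy].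
          apply in_or_app. now left.
        * destruct (H2 p0 x Hp0 Hx) as [p' [Hp' Hx']]. exists p'. split; [|easy].
          apply in_or_app. now right.
      + intros p' Hp'. apply in_app_or in Hp' as [Hp'|Hp']; [|now apply H3].
        destruct (L3 p' Hp') as [C1 [C2 [C3 C4]]]. repeat split; try lra. easy. }
  destruct K as [T' [H1 [H2 H3]]]. exists T'. repeat split; auto; try apply H3; auto.
  intros x Hx. destruct (Hcov x Hx) as [p [Hp Hpx]]. now apply (H2 p).
Qed.

(** * Smooth maps: few monotone pieces or a small derivative *)

Section Tower.

Variables (U : R -> Prop) (n : nat) (D : nat -> R -> R) (B : R).
Hypothesis Hconv : convex_set U.
Hypothesis Hder : forall j, (S j <= n)%nat ->
  forall x, U x -> has_deriv_within U (D j) x (D (S j) x).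
Hypothesis Hcont : forall j, (j <= n)%nat -> cont_within U (D j).
Hypothesis HB : 0 <= B.
Hypothesis Htop : forall x, U x -> Rabs (D n x) <= B.

(** Descending induction on the order of the derivative. If [D (S j)] is small, then [D j] either
    has a zero and is small by the mean value theorem, or has constant sign. If [D (S j)] has
    constant sign on each piece, then [D j] is monotone there, and one cut per piece doubles their
    number. *)
Lemma tower_alternative (u v : R) : U u -> U v -> u <= v ->
  forall m j, (j + m = n)%nat ->
  (forall z, u <= z <= v -> Rabs (D j z) <= B * (v - u) ^ m) \/ split_sign (D j) (2 ^ m) u v.
Proof.
  intros Uu Uv Huv. induction m as [|m IH]; intros j Hj.
  - left. intros z Hz. replace j with n by lia. rewrite pow_O, Rmult_1_r.
    apply Htop. now apply (Hconv u v).
  - destruct (IH (S j) ltac:(lia)) as [Hs|[T [HT [Hcov HTs]]]].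
    + destruct (classic (exists z, u <= z <= v /\ D j z = 0)) as [[z0 [Hz0 Hz]]|Hn].
      * left. intros z Hzz. replace (D j z) with (D j z - D j z0) by lra.
        apply Rle_trans with (B * (v - u) ^ m * Rabs (z - z0)).
        -- apply (within_contraction U (D j) (D (S j)) _ u v); auto. apply Hder. lia.
        -- simpl. rewrite (Rmult_comm (v - u)), <- Rmult_assoc. apply Rmult_le_compat_l.
           ++ apply Rmult_le_pos; [easy | apply pow_le; lra].
           ++ unfold Rabs. destruct Rcase_abs; lra.
      * right. exists ((u, v) :: nil). split.
        { simpl. assert (2 ^ m <> 0)%nat by (apply Nat.pow_nonzero; lia). lia. }
        split.
        { intros x Hx. exists (u, v). split; [now left | easy]. }
        intros p [<-|[]]. cbn [fst snd]. repeat split; try lra.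
        destruct (Rle_dec 0 (D j u)) as [Hu|Hu]; [left | right]; intros z Hz;
        apply Rnot_lt_le; intros Hlt; apply Hn;
        (destruct (cont_within_IVT U (D j) u z 0) as [x [Hx Hx0]]; auto;
         [ apply Hcont; lia | apply (Hconv u v); auto; lra | lra
         | split; [apply Rle_trans with (Rmin (D j u) (D j z)); [lra|] |];
           unfold Rmin, Rmax; repeat destruct Rle_dec; lra
         | exists x; split; [lra | easy] ]).
    + right. destruct (split_sign_refine (D j) 2 u v T) as [T' [H1 [H2 H3]]];
        auto.
      * intros p Hp. destruct (HTs p Hp) as [C1 [C2 [C3 C4]]]. lra.
      * intros p Hp. destruct (HTs p Hp) as [C1 [C2 [C3 C4]]].
        assert (U (fst p)) by (apply (Hconv u v); auto; lra).
        assert (U (snd p)) by (apply (Hconv u v); auto; lra).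
        apply (mono_split_sign U); auto; [apply Hcont; lia|].
        apply (const_sign_mono U _ (D (S j))); auto. apply Hder. lia.
      * exists T'. repeat split; auto; try apply H3; auto.
        apply Nat.le_trans with (1 := H1). simpl. lia.
Qed.

Lemma tower_split_mono (r1 : nat) (g : R -> R) (u v : R) : n = S r1 ->
  (forall x, U x -> D 0%nat x = g x) -> U u -> U v -> u <= v ->
  split_mono g (2 ^ r1) u v \/ forall z, u <= z <= v -> Rabs (D 1%nat z) <= B * (v - u) ^ r1.
Proof.
  intros Hn Hg Uu Uv Huv.
  destruct (tower_alternative u v Uu Uv Huv r1 1 ltac:(lia)) as [H|[T [H1 [H2 H3]]]].
  - now right.
  - left. exists T. repeat split; auto; try apply H3; auto.
    destruct (H3 p H) as [C1 [C2 [C3 C4]]].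
    assert (Up : U (fst p)) by (apply (Hconv u v); auto; lra).
    assert (Uq : U (snd p)) by (apply (Hconv u v); auto; lra).
    apply (const_sign_mono U _ (D 1%nat)); auto.
    intros x Ux. apply has_deriv_within_ext with (D 0%nat); auto. apply Hder; [lia | easy].
Qed.

End Tower.

(** * Derivatives of iterates and their growth *)

Section Iterates.

Variables (U : R -> Prop) (g g1 : R -> R).
Hypothesis HgU : forall x, U x -> U (g x).
Hypothesis Hder : forall x, U x -> has_deriv_within U g x (g1 x).

Fixpoint deriv_iter (n : nat) (x : R) : R :=
  match n with O => 1 | S n' => g1 (iter g n' x) * deriv_iter n' x end.

Lemma deriv_iter_S_r (n : nat) (x : R) : deriv_iter (S n) x = deriv_iter n (g x) * g1 x.
Proof.
  induction n as [|n IH]; [simpl; ring|].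
  change (deriv_iter (S (S n)) x) with (g1 (iter g (S n) x) * deriv_iter (S n) x).
  rewrite IH, iter_S_r. simpl. ring.
Qed.

Lemma deriv_iter_add (n m : nat) (x : R) :
  deriv_iter (n + m) x = deriv_iter n (iter g m x) * deriv_iter m x.
Proof.
  induction n as [|n IH]; [simpl; ring|]. simpl. rewrite IH, iter_add. ring.
Qed.

Lemma has_deriv_within_iter (n : nat) (x : R) : U x ->
  has_deriv_within U (iter g n) x (deriv_iter n x).
Proof.
  intros Ux. induction n as [|n IH]; simpl.
  - apply linear_has_deriv_within. intros eps He. exists 1. split; [lra|].
    intros y _ _. replace (y - x - 1 * (y - x)) with 0 by ring.
    rewrite Rabs_R0. apply Rmult_le_pos; [lra | apply Rabs_pos].
  - apply (has_deriv_within_comp U g (iter g n)); auto.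
    + intros y Uy. now apply iter_in.
    + apply Hder. now apply iter_in.
Qed.

Lemma deriv_iter_bound (M : R) (n : nat) (x : R) : U x ->
  (forall y, U y -> Rabs (g1 y) <= M) -> Rabs (deriv_iter n x) <= M ^ n.
Proof.
  intros Ux HM. induction n as [|n IH]; simpl; [rewrite Rabs_R1; lra|].
  rewrite Rabs_mult. apply Rmult_le_compat; try apply Rabs_pos; auto.
  now apply HM, iter_in.
Qed.

(** The orbit is cut into blocks of length [p]; the incomplete block costs at most M^p. *)
Lemma deriv_iter_growth (M K : R) (p : nat) : 1 <= M -> 1 <= K -> (1 <= p)%nat ->
  (forall y, U y -> Rabs (g1 y) <= M) ->
  (forall y, U y -> Rabs (deriv_iter p y) <= K ^ p) ->
  forall n x, U x -> Rabs (deriv_iter n x) <= M ^ p * K ^ n.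
Proof.
  intros HM HK Hp Hb HbK n. induction n as [n IH] using lt_wf_ind. intros x Ux.
  assert (H1 : 1 <= M ^ p) by now apply pow_ge_1.
  assert (H2 : 1 <= K ^ n) by now apply pow_ge_1.
  destruct (Nat.lt_ge_cases n p) as [Hn|Hn].
  - apply Rle_trans with (1 := deriv_iter_bound M n x Ux Hb).
    assert (M ^ n <= M ^ p) by (apply Rle_pow; [easy | lia]). nra.
  - replace n with (p + (n - p))%nat at 1 by lia. rewrite deriv_iter_add, Rabs_mult.
    specialize (IH (n - p)%nat ltac:(lia) x Ux).
    assert (HK2 := HbK (iter g (n - p) x) (iter_in U g _ x HgU Ux)).
    replace n with (p + (n - p))%nat at 3 by lia. rewrite pow_add.
    replace (M ^ p * (K ^ p * K ^ (n - p))) with (K ^ p * (M ^ p * K ^ (n - p))) by ring.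
    apply Rmult_le_compat; auto; apply Rabs_pos.
Qed.

End Iterates.

(** * Maps close to [f] *)

(* [U] is the set on which maps are defined (the real line for lifts of circle maps), [D] the
   fundamental domain carrying the entropy, [d0] the metric of the quotient. *)
Record phase_space (U D : R -> Prop) (d0 : R -> R -> R) : Prop := mk_phase_space {
  ps_convex : convex_set U;
  ps_acc : no_isolated_point U;
  ps_D : forall x, D x -> U x /\ 0 <= x <= 1;
  ps_triangle : forall x y z, d0 x z <= d0 x y + d0 y z;
  ps_sym : forall x y, d0 x y = d0 y x;
  ps_le : forall x y, d0 x y <= Rabs (x - y);
  ps_eq : forall x y, Rabs (x - y) <= / 2 -> d0 x y = Rabs (x - y) }.

(** For lifts, values are compared only modulo the integers, so the Lipschitz bound and the uniform
    continuity of [f1] refer to [d0]. The margin in [M - 1] leaves room for maps at distance at most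
    1. [bm_rep] moves a point into the fundamental domain without changing its orbit in the
    quotient. *)
Record base_map (U D : R -> Prop) (d0 : R -> R -> R) (f f1 : R -> R) (M : R) : Prop :=
 mk_base_map {
  bm_U : forall x, U x -> U (f x);
  bm_deriv : forall x, U x -> has_deriv_within U f x (f1 x);
  bm_M : 2 <= M;
  bm_bound : forall x, U x -> Rabs (f1 x) <= M - 1;
  bm_unif : forall e, 0 < e -> exists tau, 0 < tau /\
    forall x y, U x -> U y -> d0 x y <= tau -> Rabs (f1 x - f1 y) <= e;
  bm_lip : forall x y, U x -> U y -> d0 (f x) (f y) <= M * d0 x y;
  bm_rep : forall x, U x -> exists x', D x' /\ forall k, d0 (iter f k x) (iter f k x') = 0 }.

Record near (U : R -> Prop) (d0 : R -> R -> R) (f f1 : R -> R) (tau : R) (g g1 : R -> R) : Prop :=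
 mk_near {
  nr_U : forall x, U x -> U (g x);
  nr_deriv : forall x, U x -> has_deriv_within U g x (g1 x);
  nr_d0 : forall x, U x -> d0 (f x) (g x) <= tau;
  nr_d1 : forall x, U x -> Rabs (f1 x - g1 x) <= tau }.

Lemma near_le U d0 f f1 tau tau' g g1 :
  tau <= tau' -> near U d0 f f1 tau g g1 -> near U d0 f f1 tau' g g1.
Proof.
  intros H [H1 H2 H3 H4]. split; auto; intros x Ux;
  [specialize (H3 x Ux) | specialize (H4 x Ux)]; lra.
Qed.

(* The alternative for maps of class [C^r] with [r = S r1] and [|g^(r)| <= B]. *)
Definition yomdin_split (U : R -> Prop) (r1 : nat) (B : R) (g g1 : R -> R) : Prop :=
  forall u v, U u -> U v -> u <= v ->
  split_mono g (2 ^ r1) u v \/ forall z, u <= z <= v -> Rabs (g1 z) <= B * (v - u) ^ r1.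

Lemma list_find_factor (A : Type) (x : A -> R) (c : R) (l : list A) : l <> nil -> 0 < c ->
  (forall a, In a l -> 0 <= x a) ->
  c ^ length l <= fold_right (fun a acc => x a * acc) 1 l -> exists a, In a l /\ c <= x a.
Proof.
  intros Hl Hc Hx H. apply NNPP. intros Hn.
  assert (Hlt : forall a, In a l -> x a < c).
  { intros a Ha. apply Rnot_le_lt. intros Hca. apply Hn. now exists a. }
  apply (Rle_not_lt _ _ H). clear H Hn.
  induction l as [|a l IH]; [easy|]. simpl.
  assert (Ha := Hlt a (or_introl eq_refl)). assert (Ha0 := Hx a (or_introl eq_refl)).
  assert (Hp : 0 < c ^ length l) by now apply pow_lt.
  destruct l as [|b l].
  - simpl. lra.
  - assert (IH' : fold_right (fun a acc => x a * acc) 1 (b :: l) < c ^ length (b :: l)).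
    { apply IH; [easy | intros; apply Hx; now right | intros; apply Hlt; now right]. }
    assert (H0 : 0 <= fold_right (fun a acc => x a * acc) 1 (b :: l)).
    { clear - Hx. assert (Hx' : forall a, In a (b :: l) -> 0 <= x a)
        by (intros; apply Hx; now right).
      clear Hx. induction (b :: l) as [|e m IHm]; simpl; [lra|].
      apply Rmult_le_pos; [apply Hx'; now left | apply IHm; intros; apply Hx'; now right]. }
    set (P := fold_right _ 1 (b :: l)) in *. set (Q := c ^ length (b :: l)) in *. nra.
Qed.

(** * Choice of the parameters of one window *)

Section Windows.

Variables (U D : R -> Prop) (d0 : R -> R -> R) (f f1 : R -> R) (M E B K0 : R) (r1 p : nat).
Hypothesis HS : phase_space U D d0.
Hypothesis Hf : base_map U D d0 f f1 M.
Hypothesis Hr1 : (1 <= r1)%nat.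
Hypothesis HE : 1 <= E.
Hypothesis HB : 1 <= B.
Hypothesis Hp : (1 <= p)%nat.
Hypothesis HK0 : K0 < (E ^ S r1) ^ p.
Hypothesis Hgrowth : forall x, U x -> Rabs (deriv_iter f f1 p x) <= K0.
Hypothesis Hent : forall delta, 0 < delta -> exists N Z, (1 <= N)%nat /\
  4 * INR (length Z) <= E ^ N /\
  forall x, D x -> exists z, In z Z /\
    forall j, (j < N)%nat -> d0 (iter f j x) (iter f j z) <= delta.

Let HM : 2 <= M.
Proof. exact (bm_M _ _ _ _ _ _ Hf). Qed.

Lemma near_bound tau g g1 : tau <= 1 -> near U d0 f f1 tau g g1 ->
  forall x, U x -> Rabs (g1 x) <= M.
Proof.
  intros Ht Hg x Ux. assert (H1 := bm_bound _ _ _ _ _ _ Hf x Ux).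
  assert (H2 := nr_d1 _ _ _ _ _ _ _ Hg x Ux).
  replace (g1 x) with (f1 x - (f1 x - g1 x)) by ring.
  apply Rle_trans with (1 := Rabs_triang _ _). rewrite Rabs_Ropp. lra.
Qed.

Lemma near_iter tau g g1 : 0 <= tau -> near U d0 f f1 tau g g1 ->
  forall j x, U x -> d0 (iter f j x) (iter g j x) <= tau * (INR j * M ^ j).
Proof.
  intros Ht Hg j x Ux. induction j as [|j IH].
  - simpl. assert (H := ps_le _ _ _ HS x x). rewrite Rminus_diag, Rabs_R0 in H. lra.
  - assert (Uf : U (iter f j x)) by (apply iter_in; auto; apply (bm_U _ _ _ _ _ _ Hf)).
    assert (Ug : U (iter g j x)) by (apply iter_in; auto; apply (nr_U _ _ _ _ _ _ _ Hg)).
    simpl iter.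
    apply Rle_trans with (1 := ps_triangle _ _ _ HS _ (f (iter g j x)) _).
    assert (H1 := bm_lip _ _ _ _ _ _ Hf _ _ Uf Ug).
    assert (H2 := nr_d0 _ _ _ _ _ _ _ Hg _ Ug).
    rewrite S_INR. assert (Hj : 1 <= M ^ j) by (apply pow_ge_1; lra).
    assert (M * d0 (iter f j x) (iter g j x) <= M * (tau * (INR j * M ^ j)))
      by (apply Rmult_le_compat_l; lra).
    simpl. assert (1 <= M * M ^ j) by nra.
    assert (tau * 1 <= tau * (M * M ^ j)) by (apply Rmult_le_compat_l; lra).
    replace (tau * ((INR j + 1) * (M * M ^ j)))
      with (M * (tau * (INR j * M ^ j)) + tau * (M * M ^ j)) by ring.
    lra.
Qed.

Lemma near_deriv_iter (n : nat) : forall e, 0 < e -> exists tau, 0 < tau <= 1 /\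
  forall g g1, near U d0 f f1 tau g g1 ->
  forall x, U x -> Rabs (deriv_iter g g1 n x - deriv_iter f f1 n x) <= e.
Proof.
  induction n as [|n IH]; intros e He.
  - exists 1. split; [lra|]. intros g g1 _ x _. simpl. rewrite Rminus_diag, Rabs_R0. lra.
  - assert (HMn : 1 <= M ^ n) by (apply pow_ge_1; lra).
    assert (He1 : 0 < e / (2 * M)) by (apply Rdiv_lt_0_compat; lra).
    assert (He2 : 0 < e / (4 * M ^ n)) by (apply Rdiv_lt_0_compat; lra).
    destruct (IH _ He1) as [t1 [Ht1 H1]].
    destruct (bm_unif _ _ _ _ _ _ Hf _ He2) as [t2 [Ht2 H2]].
    assert (Hn : 0 < INR n * M ^ n + 1) by (assert (H := pos_INR n); nra).
    assert (Ht3 : 0 < t2 / (INR n * M ^ n + 1)) by now apply Rdiv_lt_0_compat.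
    exists (Rmin t1 (Rmin (t2 / (INR n * M ^ n + 1)) (e / (4 * M ^ n)))).
    assert (L1 := Rmin_l t1 (Rmin (t2 / (INR n * M ^ n + 1)) (e / (4 * M ^ n)))).
    assert (L2 := Rmin_r t1 (Rmin (t2 / (INR n * M ^ n + 1)) (e / (4 * M ^ n)))).
    assert (L3 := Rmin_l (t2 / (INR n * M ^ n + 1)) (e / (4 * M ^ n))).
    assert (L4 := Rmin_r (t2 / (INR n * M ^ n + 1)) (e / (4 * M ^ n))).
    assert (Hpos : 0 < Rmin t1 (Rmin (t2 / (INR n * M ^ n + 1)) (e / (4 * M ^ n)))).
    { apply Rmin_pos; [lra|]. now apply Rmin_pos. }
    set (tau := Rmin t1 _) in *. split; [lra|].
    intros g g1 Hg x Ux.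
    assert (Hb := near_bound tau g g1 ltac:(lra) Hg).
    assert (Uf : U (iter f n x)) by (apply iter_in; auto; apply (bm_U _ _ _ _ _ _ Hf)).
    assert (Ug : U (iter g n x)) by (apply iter_in; auto; apply (nr_U _ _ _ _ _ _ _ Hg)).
    assert (A1 := H1 g g1 (near_le _ _ _ _ _ _ _ _ L1 Hg) x Ux).
    assert (A2 : Rabs (f1 (iter f n x) - f1 (iter g n x)) <= e / (4 * M ^ n)).
    { apply H2; auto. apply Rle_trans with (1 := near_iter tau g g1 ltac:(lra) Hg n x Ux).
      assert (tau <= t2 / (INR n * M ^ n + 1)) by lra.
      apply Rle_div_r in H; [|easy]. assert (H0 := pos_INR n). nra. }
    assert (A3 := nr_d1 _ _ _ _ _ _ _ Hg _ Ug).
    assert (A4 := deriv_iter_bound U g g1 (nr_U _ _ _ _ _ _ _ Hg) M n x Ux Hb).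
    assert (A5 := bm_bound _ _ _ _ _ _ Hf _ Uf).
    simpl.
    replace (g1 (iter g n x) * deriv_iter g g1 n x - f1 (iter f n x) * deriv_iter f f1 n x)
      with (f1 (iter f n x) * (deriv_iter g g1 n x - deriv_iter f f1 n x)
        - ((f1 (iter f n x) - f1 (iter g n x)) + (f1 (iter g n x) - g1 (iter g n x)))
          * deriv_iter g g1 n x) by ring.
    apply Rle_trans with (1 := Rabs_triang _ _). rewrite Rabs_Ropp, 2!Rabs_mult.
    assert (A6 : Rabs ((f1 (iter f n x) - f1 (iter g n x)) + (f1 (iter g n x) - g1 (iter g n x)))
      <= e / (2 * M ^ n)).
    { apply Rle_trans with (1 := Rabs_triang _ _).
      replace (e / (2 * M ^ n)) with (e / (4 * M ^ n) + e / (4 * M ^ n)) by (field; lra).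
      lra. }
    assert (A7 : Rabs (f1 (iter f n x)) * Rabs (deriv_iter g g1 n x - deriv_iter f f1 n x)
      <= M * (e / (2 * M))).
    { apply Rmult_le_compat; try apply Rabs_pos; [lra | easy]. }
    assert (A8 := Rmult_le_compat _ _ _ _ (Rabs_pos _) (Rabs_pos _) A6 A4).
    replace (M * (e / (2 * M))) with (e / 2) in A7 by (field; lra).
    replace (e / (2 * M ^ n) * M ^ n) with (e / 2) in A8 by (field; lra). lra.
Qed.

(** The strict inequality [HK0] at the single time [p] persists for nearby maps; blocks of length
    [p] extend it to all times, with the constant M^p as [Cp]. *)
Lemma near_growth : exists tau, 0 < tau <= 1 /\ forall g g1, near U d0 f f1 tau g g1 ->
  forall n x y, U x -> U y ->
    Rabs (iter g n x - iter g n y) <= M ^ p * (E ^ n) ^ S r1 * Rabs (x - y).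
Proof.
  destruct (near_deriv_iter p ((E ^ S r1) ^ p - K0) ltac:(lra)) as [tau [Ht H]].
  exists tau. split; [easy|]. intros g g1 Hg.
  assert (Hb := near_bound tau g g1 ltac:(lra) Hg).
  assert (HEr : 1 <= E ^ S r1) by now apply pow_ge_1.
  assert (Hd := deriv_iter_growth U g g1 (nr_U _ _ _ _ _ _ _ Hg) M (E ^ S r1) p ltac:(lra) HEr Hp Hb).
  assert (Hd' : forall n x, U x -> Rabs (deriv_iter g g1 n x) <= M ^ p * (E ^ n) ^ S r1).
  { intros n x Ux. rewrite <- pow_mult, Nat.mul_comm, pow_mult. apply Hd; auto.
    intros y Uy. assert (H1 := H g g1 Hg y Uy). assert (H2 := Hgrowth y Uy).
    replace (deriv_iter g g1 p y)
      with ((deriv_iter g g1 p y - deriv_iter f f1 p y) + deriv_iter f f1 p y) by ring.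
    apply Rle_trans with (1 := Rabs_triang _ _). lra. }
  assert (Hw : forall n x y, U x -> U y -> x <= y ->
    Rabs (iter g n x - iter g n y) <= M ^ p * (E ^ n) ^ S r1 * Rabs (x - y)).
  { intros n x y Ux Uy Hxy.
    apply (within_contraction U (iter g n) (deriv_iter g g1 n) _ x y); auto; try lra.
    - apply (ps_convex _ _ _ HS).
    - intros z Uz. apply has_deriv_within_iter; auto; apply Hg.
    - intros z Hz. apply Hd'. now apply (ps_convex _ _ _ HS x y). }
  intros n x y Ux Uy. destruct (Rle_dec x y); [auto|].
  rewrite Rabs_minus_sym, (Rabs_minus_sym x). apply Hw; auto. lra.
Qed.

(** The choices are made in this order: [Delta] from the modulus of continuity of [f1] at sigma / 4,
    [N] from the entropy of [f] at the scale Delta / 4, then omega, then tau. As [eta] comes last,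
    the same tau serves all scales. *)
Lemma window (sigma : R) : 0 < sigma ->
  4 * INR (2 ^ r1) * 4 ^ r1 * B ^ 2 * sigma <= 1 ->
  exists omega, 0 < omega <= 1 /\ exists tau, 0 < tau <= 1 /\
  forall g g1, near U d0 f f1 tau g g1 -> yomdin_split U r1 B g g1 ->
  forall eta, 0 < eta <= 1 -> exists C, 0 <= C /\
  forall k Y, NoDup Y -> (forall y, In y Y -> U y /\ 0 <= y <= 1) -> good g eta k Y ->
    wsum (weight g g1 sigma omega k) Y <= C * E ^ k.
Proof.
  intros Hs Hs1.
  destruct near_growth as [t1 [Ht1 Hgr]].
  destruct (bm_unif _ _ _ _ _ _ Hf (sigma / 4) ltac:(lra)) as [t2 [Ht2 Huc]].
  assert (HMp : 1 <= M ^ p) by (apply pow_ge_1; lra).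
  assert (HEr : 1 <= E ^ S r1) by now apply pow_ge_1.
  (* [V] combines two constraints on [Delta]: [HDE] for images of length at most 1, and [HDM] for
     images within 1/2, where [d0] is the distance of the lifts. *)
  set (V := M ^ p * E ^ S r1 * M).
  assert (HV : 2 <= V).
  { unfold V. assert (1 <= M ^ p * E ^ S r1) by nra. nra. }
  set (Delta := Rmin t2 (/ (2 * V))).
  assert (HDV : Delta <= / (2 * V)) by apply Rmin_r.
  assert (HD0 : 0 < Delta).
  { apply Rmin_pos; [easy|]. apply Rinv_0_lt_compat; lra. }
  assert (HDV1 : V * Delta <= / 2).
  { replace (/ 2) with (V * / (2 * V)) by (field; lra). apply Rmult_le_compat_l; lra. }
  assert (HDM : M * Delta <= / 2).
  { apply Rle_trans with (2 := HDV1). apply Rmult_le_compat_r; [lra|].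
    unfold V. assert (1 <= M ^ p * E ^ S r1) by nra. nra. }
  assert (HDE : M ^ p * E ^ S r1 * Delta <= 1).
  { apply Rle_trans with (V * Delta); [|lra]. apply Rmult_le_compat_r; [lra|].
    unfold V. assert (1 <= M ^ p * E ^ S r1) by nra. nra. }
  assert (HD1 : Delta <= 1) by nra.
  destruct (Hent (Delta / 4) ltac:(lra)) as [N [Z [HN [HZ Hspan]]]].
  assert (HEN : 1 <= E ^ N) by now apply pow_ge_1.
  assert (Hcr : (1 <= 2 ^ r1)%nat).
  { assert (2 ^ r1 <> 0)%nat by (apply Nat.pow_nonzero; lia). lia. }
  assert (Hcr1 : 1 <= INR (2 ^ r1)) by (apply (le_INR 1); lia).
  (* With omega = Delta / W, the hypothesis [Homega1] of the counting estimate holds with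
     equality. *)
  set (W := 4 * INR (2 ^ r1) * (M ^ p * B) * E ^ N).
  assert (HW : 1 <= W).
  { unfold W. assert (1 <= M ^ p * B) by nra. assert (1 <= INR (2 ^ r1) * (M ^ p * B)) by nra.
    assert (1 <= INR (2 ^ r1) * (M ^ p * B) * E ^ N) by nra. nra. }
  exists (Delta / W). split.
  { split; [apply Rdiv_lt_0_compat; lra|]. apply Rle_div_l; lra. }
  assert (HMN : 1 <= M ^ N) by (apply pow_ge_1; lra).
  assert (HNI : 1 <= INR N) by (apply (le_INR 1); lia).
  set (t3 := Delta / (4 * (INR N * M ^ N))).
  assert (Hq0 : 1 <= INR N * M ^ N) by nra.
  assert (Ht3 : 0 < t3) by (apply Rdiv_lt_0_compat; lra).
  exists (Rmin t1 (Rmin (sigma / 4) t3)).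
  assert (L1 := Rmin_l t1 (Rmin (sigma / 4) t3)).
  assert (L2 := Rmin_r t1 (Rmin (sigma / 4) t3)).
  assert (L3 := Rmin_l (sigma / 4) t3). assert (L4 := Rmin_r (sigma / 4) t3).
  assert (Hpos : 0 < Rmin t1 (Rmin (sigma / 4) t3)).
  { apply Rmin_pos; [lra|]. apply Rmin_pos; lra. }
  set (tau := Rmin t1 _) in *. split; [lra|].
  intros g g1 Hg Hy eta Heta.
  exists (core_const N E eta). split.
  { apply Rle_trans with 1; [lra|]. now apply core_const_pos. }
  intros k Y Hd Hin Hgood.
  assert (Hconv := ps_convex _ _ _ HS).
  assert (HgU := nr_U _ _ _ _ _ _ _ Hg). assert (Hgd := nr_deriv _ _ _ _ _ _ _ Hg).
  assert (Hgb := near_bound tau g g1 ltac:(lra) Hg).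
  assert (Hgad := Hgr g g1 (near_le _ _ _ _ _ _ _ _ L1 Hg)).
  assert (Hglip : forall u v, U u -> U v -> u <= v -> Rabs (g u - g v) <= M * Rabs (u - v)).
  { intros u v Uu Uv Huv. apply (within_contraction U g g1 M u v); auto; try lra.
    intros z Hz. apply Hgb. now apply (Hconv u v). }
  assert (Hglip' : forall u v, U u -> U v -> Rabs (g u - g v) <= M * Rabs (u - v)).
  { intros u v Uu Uv. destruct (Rle_dec u v); [auto|].
    rewrite Rabs_minus_sym, (Rabs_minus_sym u). apply Hglip; auto. lra. }
  assert (Y = nil \/ Y <> nil) as [->|HY] by (destruct Y; [now left | now right]).
  { simpl. apply Rmult_le_pos; [|apply pow_le; lra].
    apply Rle_trans with 1; [lra|]. now apply core_const_pos. }
  destruct (list_Rmin Y HY) as [lo [Hlo Hlo1]]. destruct (list_Rmax Y HY) as [hi [Hhi Hhi1]].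
  destruct (Hin lo Hlo) as [Ulo Ilo]. destruct (Hin hi Hhi) as [Uhi Ihi].
  assert (Hlh := Hlo1 hi Hhi).
  (* The induction starts untracked with the size M^p, which is admissible because the points lie
     within distance 1. *)
  apply Rle_trans with (core_bound N E Delta eta k 0 (M ^ p)).
  - apply (core_claim U g g1 r1 (2 ^ r1) N E B (M ^ p) Delta sigma (Delta / W) eta)
      with (lo := lo) (hi := hi); auto; try lra.
    + intros u v c Uu Uv Huv Hc. apply (cont_within_IVT U); auto.
      intros x Ux. now apply has_deriv_within_cont with (g1 x), Hgd.
    + intros u v m Uu Uv Huv Hm x y Hx Hxy.
      apply Rle_trans with (m * Rabs (x - y)).
      * apply (within_contraction U g g1 m u v); auto.
      * apply Rmult_le_compat_l.
        -- apply Rle_trans with (2 := Hm u ltac:(lra)). apply Rabs_pos.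
        -- unfold Rabs. destruct Rcase_abs; lra.
    + intros u v Uu Uv Huv Hl.
      destruct (classic (exists z0, u <= z0 <= v /\ sigma < Rabs (g1 z0))) as [[z0 [Hz0 Hz]]|Hn].
      2:{ right. intros z Hz. apply Rnot_lt_le. intros Hlt. apply Hn. now exists z. }
      left. apply (const_sign_mono U g g1); auto.
      assert (Uz0 : U z0) by now apply (Hconv u v).
      (* One quarter of sigma is the oscillation of [f1], the other two are the distances from [f1]
         to [g1] at both points; so [g1] cannot change sign once it exceeds sigma in absolute
         value. *)
      assert (Hcl : forall z, u <= z <= v -> Rabs (g1 z - g1 z0) <= 3 / 4 * sigma).
      { intros z Hzz. assert (Uz : U z) by now apply (Hconv u v).
        assert (A1 := nr_d1 _ _ _ _ _ _ _ Hg _ Uz). assert (A2 := nr_d1 _ _ _ _ _ _ _ Hg _ Uz0).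
        assert (A3 : Rabs (f1 z - f1 z0) <= sigma / 4).
        { apply Huc; auto. apply Rle_trans with (1 := ps_le _ _ _ HS z z0).
          apply Rle_trans with Delta; [|apply Rmin_l].
          unfold Rabs. destruct Rcase_abs; lra. }
        revert A1 A2 A3. unfold Rabs. repeat destruct Rcase_abs; lra. }
      destruct (Rle_dec 0 (g1 z0)) as [H0|H0]; [left | right]; intros z Hzz;
      specialize (Hcl z Hzz); revert Hz Hcl; unfold Rabs; repeat destruct Rcase_abs; lra.
    + intros u v Uu Uv Huv Hl.
      (* The quarters make [d0] agree with the distance of the lifts, at time 0 and then,
         as [M * Delta <= 1/2], at all later times. *)
      set (Q := fun (zi : R * R) y => u + snd zi / 4 <= y <= u + (snd zi + 1) / 4 /\
         forall j, (j < N)%nat -> d0 (iter f j (fst zi)) (iter g j y) <= Delta / 2).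
      exists (map Q (list_prod Z (0 :: 1 :: 2 :: 3 :: nil))). repeat split.
      (* The factor 4 in [Hent] pays for the four quarters. *)
      * rewrite length_map, length_prod, mult_INR. simpl length.
        replace (INR 4) with 4 by (simpl; ring). lra.
      * intros y Hyy. assert (Uy : U y) by now apply (Hconv u v).
        destruct (bm_rep _ _ _ _ _ _ Hf y Uy) as [y' [Dy' Hy']].
        destruct (Hspan y' Dy') as [z [Hz Hzj]].
        assert (Hi : exists i, In i (0 :: 1 :: 2 :: 3 :: nil) /\
           u + i / 4 <= y <= u + (i + 1) / 4).
        { destruct (Rle_dec y (u + 1 / 4)); [exists 0; simpl; split; [tauto | lra]|].
          destruct (Rle_dec y (u + 2 / 4)); [exists 1; simpl; split; [tauto | lra]|].
          destruct (Rle_dec y (u + 3 / 4)); [exists 2; simpl; split; [tauto | lra]|].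
          exists 3; simpl; split; [tauto | lra]. }
        destruct Hi as [i [Hi Hiy]].
        exists (Q (z, i)). split; [now apply in_map, in_prod|].
        split; [easy|]. intros j Hj. simpl fst.
        apply Rle_trans with (1 := ps_triangle _ _ _ HS _ (iter f j y') _).
        assert (A1 := Hzj j Hj). rewrite (ps_sym _ _ _ HS) in A1.
        assert (A2 := ps_triangle _ _ _ HS (iter f j y') (iter f j y) (iter g j y)).
        rewrite (ps_sym _ _ _ HS (iter f j y') (iter f j y)), Hy' in A2.
        assert (A3 := near_iter tau g g1 ltac:(lra) Hg j y Uy).
        assert (A4 : tau * (INR j * M ^ j) <= Delta / 4).
        { apply Rle_trans with (t3 * (INR N * M ^ N)).
          - assert (INR j <= INR N) by (apply le_INR; lia).
            assert (M ^ j <= M ^ N) by (apply Rle_pow; [lra | lia]).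
            assert (0 <= INR j) by apply pos_INR.
            assert (0 <= M ^ j) by (apply pow_le; lra).
            apply Rmult_le_compat; [lra | nra | lra | nra].
          - unfold t3. right. field. lra. }
        lra.
      * intros P HP y y' Hyy Hyy' HPy HPy'.
        apply in_map_iff in HP as [[z i] [<- _]].
        destruct HPy as [I1 J1]. destruct HPy' as [I2 J2]. cbn [fst snd] in *.
        assert (Uy : U y) by now apply (Hconv u v).
        assert (Uy' : U y') by now apply (Hconv u v).
        assert (Hstep : forall j, (j < N)%nat -> Rabs (iter g j y - iter g j y') <= / 2 ->
           Rabs (iter g j y - iter g j y') <= Delta).
        { intros j Hj H2. rewrite <- (ps_eq _ _ _ HS) by easy.
          apply Rle_trans with (1 := ps_triangle _ _ _ HS _ (iter f j z) _).
          specialize (J1 j Hj). specialize (J2 j Hj). rewrite (ps_sym _ _ _ HS) in J1. lra. }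
        induction j as [|j IH]; intros Hj; apply Hstep; auto.
        -- simpl. unfold Rabs. destruct Rcase_abs; lra.
        -- assert (A := IH ltac:(lia)). simpl.
           apply Rle_trans with (1 := Hglip' _ _ (iter_in U g j y HgU Uy) (iter_in U g j y' HgU Uy')).
           nra.
    + apply Rdiv_lt_0_compat; lra.
    + unfold W. right. field. repeat split; lra.
    + split; auto; try lra; try lia.
      * intros y y' _ _ j Hj. lia.
      * assert (1 <= E ^ k) by now apply pow_ge_1. nra.
      * intros x y Hx Hyy j.
        assert (Ux : U x) by now apply (Hconv lo hi).
        assert (Uy : U y) by now apply (Hconv lo hi).
        apply Rle_trans with (1 := Hgad j x y Ux Uy).
        rewrite Rpow_mult_distr.
        assert (1 <= (E ^ j) ^ S r1) by now apply pow_ge_1, pow_ge_1.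
        assert (M ^ p <= (M ^ p) ^ S r1) by (apply self_le_pow; [easy | lia]).
        assert (Rabs (x - y) <= 1) by (unfold Rabs; destruct Rcase_abs; lra).
        assert (H0' := Rabs_pos (x - y)).
        apply Rle_trans with (M ^ p * (E ^ j) ^ S r1 * 1).
        -- apply Rmult_le_compat_l; nra.
        -- nra.
  - unfold core_bound. rewrite pow_O, Rinv_1.
    assert (A := core_const_pos N E eta HE Heta).
    assert (1 <= E ^ k) by now apply pow_ge_1.
    rewrite <- (Rmult_1_r (core_const N E eta * E ^ k)) at 2.
    apply Rmult_le_compat_l; [nra | apply Rmin_l].
Qed.

End Windows.

(** * Chains of windows *)

Definition phis (ws : list (R * R)) (v : R) : R :=
  fold_right (fun so acc => phi (fst so) (snd so) v * acc) 1 ws.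

Definition weights (g g1 : R -> R) (ws : list (R * R)) (k : nat) (y : R) : R :=
  fold_right (fun so acc => weight g g1 (fst so) (snd so) k y * acc) 1 ws.

Lemma weights_S g g1 ws k y :
  weights g g1 ws (S k) y = phis ws (g1 y) * weights g g1 ws k (g y).
Proof.
  induction ws as [|so ws IH]; [simpl; ring|].
  unfold weights, phis in *. cbn [fold_right]. rewrite IH. simpl. ring.
Qed.

Lemma phi_nonneg s o v : 0 < o -> 0 <= phi s o v.
Proof.
  intros Ho. unfold phi. destruct Rle_dec; [|lra].
  apply Rle_trans with o; [lra | apply Rmax_r].
Qed.

Lemma weight_nonneg g g1 s o k y : 0 < o -> 0 <= weight g g1 s o k y.
Proof.
  intros Ho. revert y. induction k as [|k IH]; intros y; simpl; [lra|].
  apply Rmult_le_pos; [now apply phi_nonneg | apply IH].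
Qed.

(** By the chain rule, the pointwise comparison of |v|^4 with the product of the factors multiplies
    along the orbit. *)
Lemma weights_deriv (U : R -> Prop) g g1 M ws k y : (forall x, U x -> U (g x)) -> 1 <= M ->
  (forall x, U x -> Rabs (g1 x) <= M) -> (forall so, In so ws -> 0 < snd so) ->
  (forall v, Rabs v <= M -> Rabs v ^ 4 <= phis ws v * M ^ 4) -> U y ->
  Rabs (deriv_iter g g1 k y) ^ 4 <= weights g g1 ws k y * (M ^ 4) ^ k.
Proof.
  intros HgU HM Hb Hpos Hphi. revert y. induction k as [|k IH]; intros y Uy.
  - simpl. rewrite Rabs_R1.
    assert (weights g g1 ws 0 y = 1) as ->; [|lra].
    clear. induction ws as [|so ws IH]; [easy|].
    unfold weights in *. cbn [fold_right]. rewrite IH. simpl. ring.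
  - rewrite deriv_iter_S_r, Rabs_mult, Rpow_mult_distr, weights_S.
    specialize (IH (g y) (HgU y Uy)). specialize (Hphi (g1 y) (Hb y Uy)).
    change ((M ^ 4) ^ S k) with (M ^ 4 * (M ^ 4) ^ k).
    replace (phis ws (g1 y) * weights g g1 ws k (g y) * (M ^ 4 * (M ^ 4) ^ k))
      with (weights g g1 ws k (g y) * (M ^ 4) ^ k * (phis ws (g1 y) * M ^ 4)) by ring.
    apply Rmult_le_compat; auto; apply pow_le, Rabs_pos.
Qed.

Lemma phis_above ws v : (forall so, In so ws -> fst so < Rabs v) -> phis ws v = 1.
Proof.
  induction ws as [|[s o] ws IH]; intros H; [easy|].
  unfold phis in *. cbn [fold_right fst snd]. rewrite IH by (intros; apply H; now right).
  specialize (H (s, o) (or_introl eq_refl)). simpl in H.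
  unfold phi. destruct Rle_dec; lra.
Qed.

Section MultiWindows.

Variables (U D : R -> Prop) (d0 : R -> R -> R) (f f1 : R -> R) (M E B sigma_max : R) (r1 : nat).
Hypothesis Hf : base_map U D d0 f f1 M.
Hypothesis HE : 1 <= E.
Hypothesis Hsmax : 0 < sigma_max <= 1.

Definition window_bound (sigma omega tau : R) : Prop :=
  forall g g1, near U d0 f f1 tau g g1 -> yomdin_split U r1 B g g1 ->
  forall eta, 0 < eta <= 1 -> exists C, 0 <= C /\
  forall k Y, NoDup Y -> (forall y, In y Y -> U y /\ 0 <= y <= 1) -> good g eta k Y ->
    wsum (weight g g1 sigma omega k) Y <= C * E ^ k.

Hypothesis Hwin : forall sigma, 0 < sigma <= sigma_max ->
  exists omega, 0 < omega <= 1 /\ exists tau, 0 < tau <= 1 /\ window_bound sigma omega tau.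

(* Each threshold lies below the product of all the floors chosen before it, so that
   among the factors of [phis ws v] at most one is a cube and the floors cost one power of [v]. *)
Lemma window_chain (n : nat) : forall sigma Pi, 0 < sigma <= sigma_max -> sigma <= Pi -> Pi <= 1 ->
  exists ws, length ws = n /\
  (forall so, In so ws -> fst so <= sigma /\ 0 < snd so) /\
  (forall v, Rabs v <= sigma -> Rabs v ^ 4 <= Pi * phis ws v) /\
  exists tau, 0 < tau <= 1 /\ forall so, In so ws -> window_bound (fst so) (snd so) tau.
Proof.
  induction n as [|n IH]; intros sigma Pi Hs HsP HP.
  - exists nil. repeat split; try easy.
    + intros v Hv. unfold phis. simpl fold_right. rewrite Rmult_1_r.
      apply Rle_trans with (Rabs v); [|lra].
      apply pow_le_self; [|lia]. split; [apply Rabs_pos | lra].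
    + exists 1. split; [lra | easy].
  - destruct (Hwin sigma Hs) as [o [Ho [t1 [Ht1 Hw]]]].
    assert (HPo : 0 < Pi * o) by (apply Rmult_lt_0_compat; lra).
    assert (HPo1 : Pi * o <= 1) by nra.
    destruct (IH (Rmin sigma (Pi * o)) (Pi * o)) as [ws [Hl [Hb [Hv [t2 [Ht2 Hws]]]]]].
    { split; [apply Rmin_pos; lra|]. apply Rle_trans with sigma; [apply Rmin_l | lra]. }
    { apply Rmin_r. }
    { easy. }
    exists ((sigma, o) :: ws). repeat split.
    + simpl. now rewrite Hl.
    + destruct H as [<-|H]; [simpl; lra|].
      apply Rle_trans with (Rmin sigma (Pi * o)); [now apply Hb | apply Rmin_l].
    + destruct H as [<-|H]; [simpl; lra | now apply Hb].
    + intros v Hvs. assert (Hv0 := Rabs_pos v).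
      change (phis ((sigma, o) :: ws) v) with (phi sigma o v * phis ws v).
      assert (Hphi : phi sigma o v = Rmax (Rabs v ^ 3) o).
      { unfold phi. now destruct Rle_dec. }
      rewrite Hphi.
      destruct (Rle_dec (Rabs v) (Rmin sigma (Pi * o))) as [Hsm|Hbig].
      * apply Rle_trans with (1 := Hv v Hsm). rewrite Rmult_assoc.
        apply Rmult_le_compat_l; [lra|]. apply Rmult_le_compat_r; [|apply Rmax_r].
        clear - Hb. induction ws as [|so ws IH]; [simpl; lra|].
        unfold phis in *. cbn [fold_right]. apply Rmult_le_pos.
        -- apply phi_nonneg. now apply Hb; left.
        -- apply IH. intros so' H. apply Hb. now right.
      * rewrite phis_above.
        2:{ intros so Hso. destruct (Hb so Hso). lra. }
        rewrite Rmult_1_r. replace (Rabs v ^ 4) with (Rabs v * Rabs v ^ 3) by ring.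
        apply Rmult_le_compat; [easy | now apply pow_le | lra | apply Rmax_l].
    + exists (Rmin t1 t2). assert (L1 := Rmin_l t1 t2). assert (L2 := Rmin_r t1 t2).
      split; [split; [apply Rmin_pos; lra | lra]|].
      intros so [<-|H] g g1 Hg; [apply Hw; now apply near_le with (Rmin t1 t2) |].
      apply (Hws so H). now apply near_le with (Rmin t1 t2).
Qed.

(** With L windows and M^4 <= exp(e L), the product of the L weights at a point is at least eta^4 /
    M^(4k) >= c^L, where c = eta^4 exp(-e k). So some weight is at least c, and the estimate for
    that window allows at most C E^k / c such points. *)
Lemma family_count (e : R) : 0 < e -> exists tau, 0 < tau <= 1 /\
  forall g g1, near U d0 f f1 tau g g1 -> yomdin_split U r1 B g g1 ->
  forall eta, 0 < eta <= 1 -> exists C, 0 <= C /\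
  forall k Y, NoDup Y -> (forall y, In y Y -> U y /\ 0 <= y <= 1) -> good g eta k Y ->
    (forall y, In y Y -> eta <= Rabs (deriv_iter g g1 k y)) ->
    INR (length Y) <= C * (E * exp e) ^ k.
Proof.
  intros He. assert (HM := bm_M _ _ _ _ _ _ Hf).
  assert (Hee : 1 < exp e) by (rewrite <- exp_0; now apply exp_increasing).
  assert (HM4 : 1 <= M ^ 4) by (apply pow_ge_1; lra).
  destruct (Pow_x_infinity (exp e)) with (b := M ^ 4) as [L0 HL0].
  { rewrite Rabs_pos_eq; lra. }
  (* The successor makes the chain nonempty, so that a factor can be selected and (eta^4)^L <=
     eta^4. *)
  set (L := S L0). assert (HL : M ^ 4 <= exp e ^ L).
  { specialize (HL0 L ltac:(lia)). rewrite Rabs_pos_eq in HL0 by (apply pow_le; lra). lra. }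
  destruct (window_chain L sigma_max 1) as [ws [Hlen [Hb [Hv [tau [Ht Hws]]]]]]; try lra.
  exists tau. split; [easy|]. intros g g1 Hg Hy eta Heta.
  assert (Hgb : forall x, U x -> Rabs (g1 x) <= M).
  { intros x Ux. assert (H1 := bm_bound _ _ _ _ _ _ Hf x Ux).
    assert (H2 := nr_d1 _ _ _ _ _ _ _ Hg x Ux).
    replace (g1 x) with (f1 x - (f1 x - g1 x)) by ring.
    apply Rle_trans with (1 := Rabs_triang _ _). rewrite Rabs_Ropp. lra. }
  assert (HC : exists C, 0 <= C /\ forall so, In so ws -> forall k Y, NoDup Y ->
     (forall y, In y Y -> U y /\ 0 <= y <= 1) -> good g eta k Y ->
     wsum (weight g g1 (fst so) (snd so) k) Y <= C * E ^ k).
  { clear Hv Hlen Hb. induction ws as [|so ws IH].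
    - exists 0. split; [lra | easy].
    - destruct IH as [C1 [HC1 H1]]; [intros; apply Hws; now right|].
      destruct (Hws so (or_introl eq_refl) g g1 Hg Hy eta Heta) as [C2 [HC2 H2]].
      exists (Rmax C1 C2). split; [apply Rle_trans with (1 := HC1), Rmax_l|].
      intros so' [<-|Hso] k Y Hd Hin Hgo.
      + apply Rle_trans with (1 := H2 k Y Hd Hin Hgo).
        apply Rmult_le_compat_r; [apply pow_le; lra | apply Rmax_r].
      + apply Rle_trans with (1 := H1 so' Hso k Y Hd Hin Hgo).
        apply Rmult_le_compat_r; [apply pow_le; lra | apply Rmax_l]. }
  destruct HC as [C [HC0 HC]].
  assert (He4 : 0 < eta ^ 4 <= 1).
  { split; [apply pow_lt; lra|]. rewrite <- (pow1 4). apply pow_incr. lra. }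
  exists (INR L * C / eta ^ 4). split.
  { apply Rcomplements.Rdiv_le_0_compat; [|lra]. apply Rmult_le_pos; [apply pos_INR | easy]. }
  intros k Y Hd Hin Hgo Hde.
  assert (Hek : 1 <= exp e ^ k) by (apply pow_ge_1; lra).
  set (c := eta ^ 4 * / exp e ^ k).
  assert (Hc : 0 < c).
  { apply Rmult_lt_0_compat; [lra | apply Rinv_0_lt_compat; lra]. }
  assert (Hmain : c * INR (length Y) <= INR (length ws) * (C * E ^ k)).
  { rewrite <- wsum_const.
    apply wsum_cover with (P := fun so y => c <= weight g g1 (fst so) (snd so) k y); auto.
    - intros y HyY. destruct (Hin y HyY) as [Uy _]. apply (list_find_factor _ (fun so => weight g g1 (fst so) (snd so) k y)); auto.
      + intros ->. simpl in Hlen. easy.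
      + intros so Hso. apply weight_nonneg. now apply Hb.
      + rewrite Hlen. change (c ^ L <= weights g g1 ws k y).
        assert (Hw := weights_deriv U g g1 M ws k y (nr_U _ _ _ _ _ _ _ Hg) ltac:(lra) Hgb
          (fun so H => proj2 (Hb so H))).
        assert (Hdy : eta ^ 4 <= Rabs (deriv_iter g g1 k y) ^ 4).
        { apply pow_incr. split; [lra | now apply Hde]. }
        assert (Hw2 : Rabs (deriv_iter g g1 k y) ^ 4 <= weights g g1 ws k y * (M ^ 4) ^ k).
        { apply Hw; auto. intros v HvM.
          destruct (Rle_dec (Rabs v) sigma_max) as [Hvs|Hvs].
          - specialize (Hv v Hvs). assert (0 <= Rabs v ^ 4) by (apply pow_le, Rabs_pos). nra.
          - rewrite phis_above.
            2:{ intros so Hso. destruct (Hb so Hso). lra. }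
            rewrite Rmult_1_l. apply pow_incr. split; [apply Rabs_pos | easy]. }
        apply Rmult_le_reg_r with ((M ^ 4) ^ k); [apply pow_lt; lra|].
        apply Rle_trans with (eta ^ 4); [|lra].
        assert (Hce : c ^ L = (eta ^ 4) ^ L * / (exp e ^ L) ^ k).
        { unfold c. rewrite Rpow_mult_distr, pow_inv. do 2 f_equal.
          rewrite <- 2!pow_mult. f_equal. apply Nat.mul_comm. }
        rewrite Hce.
        assert (A1 : (eta ^ 4) ^ L <= eta ^ 4) by (apply pow_le_self; [lra | lia]).
        assert (A2 : (M ^ 4) ^ k <= (exp e ^ L) ^ k) by (apply pow_incr; lra).
        assert (A3 : 1 <= (M ^ 4) ^ k) by now apply pow_ge_1.
        rewrite Rmult_assoc. rewrite <- (Rmult_1_r (eta ^ 4)) at 2.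
        apply Rmult_le_compat; [apply pow_le; lra | | easy |].
        * apply Rmult_le_pos; [|lra]. left. apply Rinv_0_lt_compat. lra.
        * rewrite Rmult_comm. apply Rle_div_l; lra.
    - intros so Hso Y' Hd' Hi Hin'.
      apply Rle_trans with (wsum (weight g g1 (fst so) (snd so) k) Y').
      + now apply wsum_le.
      + apply HC; auto. now apply good_incl with Y. }
  rewrite Rpow_mult_distr. rewrite Hlen in Hmain.
  apply Rmult_le_reg_l with c; [easy|]. apply Rle_trans with (1 := Hmain).
  unfold c. right. field. split; lra.
Qed.

End MultiWindows.

(** * Separated sets and entropy *)

Lemma Rbar_le_of_gt (x y : Rbar) :
  (forall l : R, Rbar_lt y l -> Rbar_le x l) -> Rbar_le x y.
Proof.
  intros H. destruct x as [x| |], y as [y| |]; simpl in *; try easy.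
  - apply Rnot_lt_le. intros Hlt. specialize (H ((x + y) / 2) ltac:(lra)). lra.
  - specialize (H (x - 1) I). lra.
  - now apply (H (y + 1)); lra.
  - now apply (H 0).
Qed.

(** [ln] takes the value 0 on nonpositive numbers, whence the condition [0 <= b]. *)
Lemma ln_le_of_le (x b : R) : 0 <= b -> x <= exp b -> ln x <= b.
Proof.
  intros Hb Hx. destruct (Rlt_dec 0 x) as [H|H].
  - rewrite <- (ln_exp b). now apply ln_le.
  - unfold ln. destruct (Rlt_dec 0 x); [easy | easy].
Qed.

Lemma sep_max_le D d0 g n eps c : 0 <= c ->
  (forall l, separated D d0 g n eps l -> INR (length l) <= c) ->
  real (sep_max D d0 g n eps) <= c.
Proof.
  intros Hc H. unfold sep_max.
  destruct (Lub_Rbar_correct (fun t => exists l, separated D d0 g n eps l /\ t = INR (length l)))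
    as [_ H2].
  assert (Hu : Rbar_le (Lub_Rbar (fun t => exists l, separated D d0 g n eps l /\
     t = INR (length l))) c).
  { apply H2. intros x [l [Hl ->]]. simpl. now apply H. }
  destruct (Lub_Rbar _); simpl in *; easy.
Qed.

Lemma sep_max_ge D d0 g n eps c l : 
  (forall l, separated D d0 g n eps l -> INR (length l) <= c) ->
  separated D d0 g n eps l -> INR (length l) <= real (sep_max D d0 g n eps).
Proof.
  intros H Hl. unfold sep_max.
  destruct (Lub_Rbar_correct (fun t => exists l, separated D d0 g n eps l /\ t = INR (length l)))
    as [H1 H2].
  assert (Hu : Rbar_le (Lub_Rbar (fun t => exists l, separated D d0 g n eps l /\
     t = INR (length l))) c).
  { apply H2. intros x [l' [Hl' ->]]. simpl. now apply H. }
  assert (Hlo : Rbar_le (INR (length l)) (Lub_Rbar (fun t => exists l, separated D d0 g n eps l /\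
     t = INR (length l)))).
  { apply H1. now exists l. }
  destruct (Lub_Rbar _); simpl in *; easy.
Qed.

Lemma htop_le D d0 g (L : R) : 0 <= L ->
  (forall eps, 0 < eps -> forall e, 0 < e -> exists C, 1 <= C /\
     forall n l, separated D d0 g n eps l -> INR (length l) <= C * exp (L + e) ^ n) ->
  Rbar_le (htop D d0 g) L.
Proof.
  intros HL H. unfold htop, Rbar_lub. destruct (Rbar_ex_lub _) as [b [Hb0 Hb]]. simpl.
  apply Hb. intros v [eps [Heps ->]]. apply Rbar_le_of_gt. intros l Hl. simpl in Hl.
  rewrite <- (LimSup_seq_const l). apply LimSup_le.
  set (e := (l - L) / 2). destruct (H eps Heps e ltac:(unfold e; lra)) as [C [HC Hs]].
  assert (He : 0 < e) by (unfold e; lra).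
  assert (HlC : 0 <= ln C) by (rewrite <- ln_1; apply ln_le; lra).
  assert (HNex : exists N, ln C / e < INR N + 1).
  { destruct (nfloor_ex (ln C / e)) as [N HN]; [apply Rcomplements.Rdiv_le_0_compat; lra|].
    now exists N. }
  destruct HNex as [N HN]. exists (S N). intros n Hn.
  assert (Hn0 : INR (S N) <= INR n) by now apply le_INR. rewrite S_INR in Hn0.
  assert (Hn1 : 0 < INR n) by (assert (H0 := pos_INR N); lra).
  apply Rle_div_l; [easy|].
  apply ln_le_of_le; [apply Rmult_le_pos; lra|].
  apply Rle_trans with (C * exp (L + e) ^ n).
  - apply sep_max_le; [|now apply Hs].
    apply Rmult_le_pos; [lra|]. apply pow_le. left. apply exp_pos.
  - rewrite <- (exp_ln C), <- (exp_ln (exp (L + e) ^ n)), <- exp_plus by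
      (try lra; apply pow_lt, exp_pos).
    rewrite ln_pow, ln_exp by apply exp_pos.
    assert (ln C <= e * INR n).
    { apply Rle_trans with (e * (ln C / e)); [right; field; lra|].
      apply Rmult_le_compat_l; lra. }
    assert (Hle : ln C + INR n * (L + e) <= l * INR n).
    { replace l with (L + e + e) by (unfold e; field). lra. }
    destruct Hle as [Hlt| ->]; [left; now apply exp_increasing | right; easy].
Qed.

Lemma nat_maximum (P : nat -> Prop) (b : nat) : (exists m, P m) -> (forall m, P m -> (m <= b)%nat) ->
  exists m, P m /\ forall m', P m' -> (m' <= m)%nat.
Proof.
  revert P. induction b as [|b IH]; intros P [m Hm] Hb.
  - exists m. split; [easy|]. intros m' Hm'. apply Hb in Hm, Hm'. lia.
  - destruct (classic (P (S b))) as [H|H].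
    + exists (S b). split; [easy | exact Hb].
    + apply IH; [now exists m|]. intros m' Hm'.
      assert (m' <> S b) by (intros ->; easy). apply Hb in Hm'. lia.
Qed.

Lemma maximal_separated_spanning D d0 f n delta c : 0 <= delta ->
  (forall x, d0 x x <= 0) -> (forall x y, d0 x y = d0 y x) ->
  (forall l, separated D d0 f n delta l -> INR (length l) <= c) ->
  exists Z, separated D d0 f n delta Z /\
    forall x, D x -> exists z, In z Z /\
      forall j, (j < n)%nat -> d0 (iter f j x) (iter f j z) <= delta.
Proof.
  intros Hdelta Hd0 Hsym Hc.
  destruct (INR_unbounded c) as [b Hb].
  destruct (nat_maximum (fun m => exists l, separated D d0 f n delta l /\ length l = m) b)
    as [m [[Z [HZ Hm]] Hmax]].
  - exists 0%nat, nil. split; [|easy]. split; [apply NoDup_nil | easy].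
  - intros m [l [Hl <-]]. apply Hc in Hl. apply INR_le. lra.
  - exists Z. split; [easy|]. intros x Dx. apply NNPP. intros Hn.
    assert (Hfar : forall z, In z Z -> exists k, (k < n)%nat /\ delta < d0 (iter f k x) (iter f k z)).
    { intros z Hz. apply NNPP. intros Hn2. apply Hn. exists z. split; [easy|].
      intros j Hj. apply Rnot_lt_le. intros Hlt. apply Hn2. now exists j. }
    assert (HxZ : ~ In x Z).
    { intros Hx. destruct (Hfar x Hx) as [k [_ Hk]]. specialize (Hd0 (iter f k x)). lra. }
    assert (Hlen : (length (x :: Z) <= m)%nat).
    { apply Hmax. exists (x :: Z). split; [|easy]. destruct HZ as [H1 [H2 H3]].
      split; [now constructor|]. split.
      - intros y [<-|Hy]; auto.
      - intros y y' [<-|Hy] [<-|Hy'] Hyy; auto; try easy.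
        destruct (Hfar y Hy) as [k Hk]. exists k. now rewrite Hsym. }
    simpl in Hlen. lia.
Qed.

Section Entropy.

Variables (U D : R -> Prop) (d0 : R -> R -> R).
Hypothesis HS : phase_space U D d0.

Lemma lipschitz_separated f n delta K l : 0 < delta -> 0 < K ->
  (forall j x y, (j < n)%nat -> U x -> U y -> d0 (iter f j x) (iter f j y) <= K * Rabs (x - y)) ->
  separated D d0 f n delta l -> INR (length l) <= K / delta + 1.
Proof.
  intros Hd HK HL [H1 [H2 H3]].
  assert (H := count_separated (delta / K) l (Rdiv_lt_0_compat _ _ Hd HK) H1).
  replace (K / delta + 1) with ((1 - 0) / (delta / K) + 1) by (field; lra).
  apply H; [|lra|].
  - intros x y Hx Hy Hxy. destruct (H3 x y Hx Hy Hxy) as [k [Hk Hs]].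
    assert (A := HL k x y Hk (proj1 (ps_D _ _ _ HS x (H2 x Hx))) (proj1 (ps_D _ _ _ HS y (H2 y Hy)))).
    apply Rle_div_l; [easy|]. lra.
  - intros x Hx. now apply (ps_D _ _ _ HS), H2.
Qed.

(** A single time at which the growth is below h suffices, provided it is so large that exp((rho -
    h) N) >= 4. A maximal separated set is then the spanning set. *)
Lemma entropy_spanning f f1 M (h rho : R) : base_map U D d0 f f1 M -> h < rho -> 0 <= rho ->
  Rbar_lt (htop D d0 f) h -> forall delta, 0 < delta -> exists N Z, (1 <= N)%nat /\
  4 * INR (length Z) <= exp rho ^ N /\
  forall x, D x -> exists z, In z Z /\
    forall j, (j < N)%nat -> d0 (iter f j x) (iter f j z) <= delta.
Proof.
  intros Hf Hh Hrho Hent delta Hdelta.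
  assert (HM := bm_M _ _ _ _ _ _ Hf).
  assert (Hfin : forall n l, separated D d0 f n delta l -> INR (length l) <= M ^ n / delta + 1).
  { intros n l. apply lipschitz_separated; auto; [apply pow_lt; lra|].
    intros j x y Hj Ux Uy.
    apply Rle_trans with (M ^ j * Rabs (x - y)).
    - clear Hj. induction j as [|j IH]; simpl.
      + rewrite Rmult_1_l. apply (ps_le _ _ _ HS).
      + assert (HfU := bm_U _ _ _ _ _ _ Hf).
        apply Rle_trans with (1 := bm_lip _ _ _ _ _ _ Hf _ _
          (iter_in U f j x HfU Ux) (iter_in U f j y HfU Uy)).
        rewrite Rmult_assoc. apply Rmult_le_compat_l; lra.
    - apply Rmult_le_compat_r; [apply Rabs_pos|]. apply Rle_pow; [lra | lia]. }
  assert (HN0 : exists N0, 4 <= exp (rho - h) ^ N0).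
  { assert (1 < exp (rho - h)) by (rewrite <- exp_0; apply exp_increasing; lra).
    destruct (Pow_x_infinity (exp (rho - h))) with (b := 4) as [N0 HN0].
    { rewrite Rabs_pos_eq; lra. }
    exists N0. specialize (HN0 N0 (Nat.le_refl _)).
    rewrite Rabs_pos_eq in HN0 by (apply pow_le; lra). lra. }
  destruct HN0 as [N0 HN0].
  assert (Hex : exists n, (S N0 <= n)%nat /\ ln (real (sep_max D d0 f n delta)) / INR n < h).
  { apply NNPP. intros Hn.
    assert (H1 : Rbar_le h (LimSup_seq (fun n => ln (real (sep_max D d0 f n delta)) / INR n))).
    { rewrite <- (LimSup_seq_const h). apply LimSup_le. exists (S N0). intros n Hn0.
      apply Rnot_lt_le. intros Hlt. apply Hn. now exists n. }
    assert (H2 : Rbar_le (LimSup_seq (fun n => ln (real (sep_max D d0 f n delta)) / INR n))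
      (htop D d0 f)).
    { unfold htop, Rbar_lub. destruct (Rbar_ex_lub _) as [b [Hb Hb0]]. simpl.
      apply Hb. now exists delta. }
    apply (Rbar_lt_not_le _ _ Hent). now apply Rbar_le_trans with (1 := H1). }
  destruct Hex as [N [HN HlnN]].
  assert (HN1 : 0 < INR N) by (apply lt_0_INR; lia).
  destruct (maximal_separated_spanning D d0 f N delta (M ^ N / delta + 1)) as [Z [HZ HZs]].
  - lra.
  - intros x. assert (H := ps_le _ _ _ HS x x). now rewrite Rminus_diag, Rabs_R0 in H.
  - apply (ps_sym _ _ _ HS).
  - apply Hfin.
  - exists N, Z. split; [lia|]. split; [|easy].
    assert (HZl := sep_max_ge _ _ _ _ _ _ _ (Hfin N) HZ).
    assert (Hexp : real (sep_max D d0 f N delta) <= exp h ^ N).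
    { destruct (Rlt_dec 0 (real (sep_max D d0 f N delta))) as [Hp|Hp].
      - apply Rlt_div_l in HlnN; [|easy].
        rewrite <- (exp_ln (real _)), <- (exp_ln (exp h ^ N)) by (auto; apply pow_lt, exp_pos).
        rewrite ln_pow, ln_exp by apply exp_pos. left. apply exp_increasing. lra.
      - apply Rle_trans with 0; [lra | apply pow_le; left; apply exp_pos]. }
    replace rho with ((rho - h) + h) by ring. rewrite exp_plus, Rpow_mult_distr.
    assert (1 < exp (rho - h)) by (rewrite <- exp_0; apply exp_increasing; lra).
    assert (exp (rho - h) ^ N0 <= exp (rho - h) ^ N) by (apply Rle_pow; [lra | lia]).
    apply Rmult_le_compat; try lra. apply pos_INR.
Qed.

Section SeparatedFamilies.

Variables (g g1 : R -> R).
Hypothesis HgU : forall x, U x -> U (g x).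
Hypothesis Hgd : forall x, U x -> has_deriv_within U g x (g1 x).

(* [y] lies in the half of the gap between [x] and its successor where [g^k] covers half of the
   jump, so that the other half still separates [y] from every later point. *)
Definition marks (eta : R) (n : nat) (l : list R) (x : R) (ky : nat * R) : Prop :=
  let (k, y) := ky in
  (k < n)%nat /\ U y /\ 0 <= y <= 1 /\ x <= y /\ eta <= Rabs (deriv_iter g g1 k y) /\
  forall z, In z l -> x < z -> y < z /\
    exists u v, y <= u <= z /\ y <= v <= z /\ eta < Rabs (iter g k u - iter g k v).

(** [q] is a point where g^k reaches the midpoint of the jump between [x] and its successor. Half of
    the jump exceeds eps / 2 >= eta and equals (g^k)'(y) (q - x) with q - x <= 1, so the derivative
    at [y] is at least eta. *)
Lemma marks_exist (eps eta : R) n l x x' : 0 < eta -> eta <= eps / 2 ->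
  separated D d0 g n eps l -> In x l -> In x' l -> x < x' ->
  exists ky, marks eta n l x ky.
Proof.
  intros Heta He [Hd [HD Hs]] Hx Hx' Hlt.
  destruct (list_Rmin (filter (fun z => if Rlt_dec x z then true else false) l))
    as [s [Hin Hmin]].
  { assert (H : In x' (filter (fun z => if Rlt_dec x z then true else false) l)).
    { apply filter_In. split; [easy|]. now destruct Rlt_dec. }
    intros E. now rewrite E in H. }
  apply filter_In in Hin as [Hsl Hxs]. destruct (Rlt_dec x s) as [Hxs'|]; [clear Hxs | easy].
  assert (Hsucc : forall z, In z l -> x < z -> s <= z).
  { intros z Hz Hxz. apply Hmin, filter_In. split; [easy|]. now destruct Rlt_dec. }
  destruct (Hs x s Hx Hsl ltac:(lra)) as [k [Hk Hks]].
  destruct (ps_D _ _ _ HS x (HD x Hx)) as [Ux Ix]. destruct (ps_D _ _ _ HS s (HD s Hsl)) as [Us Is].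
  assert (Hks' := Rlt_le_trans _ _ _ Hks (ps_le _ _ _ HS _ _)).
  assert (Hconv := ps_convex _ _ _ HS).
  assert (Hder : forall z, U z -> has_deriv_within U (iter g k) z (deriv_iter g g1 k z)).
  { intros z Uz. now apply has_deriv_within_iter. }
  destruct (cont_within_IVT U (iter g k) x s ((iter g k x + iter g k s) / 2)) as [q [Hq Hqv]]; auto.
  { intros z Uz. apply has_deriv_within_cont with (deriv_iter g g1 k z). now apply Hder. }
  { lra. }
  { unfold Rmin, Rmax. repeat destruct Rle_dec; lra. }
  assert (Uq : U q) by (now apply (Hconv x s)).
  destruct (within_MVT U (iter g k) (deriv_iter g g1 k) x q) as [y [Hy Hyv]]; auto; [lra|].
  assert (Uy : U y) by (now apply (Hconv x q)).
  set (a := iter g k x) in *. set (b := iter g k s) in *.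
  assert (Hab : eps / 2 < Rabs (iter g k q - a)).
  { rewrite Hqv. revert Hks'. unfold Rabs. repeat destruct Rcase_abs; lra. }
  assert (Hab2 : eps / 2 < Rabs (iter g k q - b)).
  { rewrite Hqv. revert Hks'. unfold Rabs. repeat destruct Rcase_abs; lra. }
  exists (k, y). repeat split; auto; try lra.
  - rewrite Hyv, Rabs_mult, (Rabs_pos_eq (q - x)) in Hab by lra.
    assert (H0 := Rabs_pos (deriv_iter g g1 k y)). nra.
  - assert (Hsz := Hsucc z H H0). destruct (Rle_lt_or_eq_dec q s ltac:(lra)) as [|Hqs]; [lra|].
    exfalso. unfold b in Hab2. rewrite Hqs, Rminus_diag, Rabs_R0 in Hab2. lra.
  - assert (Hsz := Hsucc z H H0). exists q, s. repeat split; try lra. unfold b in Hab2. lra.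
Qed.

(** The points are sorted by the time k of their mark, which gives the factor [INR n]. For one k the
    marks interleave with the points of [l]; hence they are distinct and form a good set. The
    maximum of [l] has no successor and accounts for the summand 1. *)
Lemma separated_count (eps eta C F : R) n l : 0 < eta -> eta <= eps / 2 -> 0 <= C -> 1 <= F ->
  (forall k Y, NoDup Y -> (forall y, In y Y -> U y /\ 0 <= y <= 1) -> good g eta k Y ->
    (forall y, In y Y -> eta <= Rabs (deriv_iter g g1 k y)) -> INR (length Y) <= C * F ^ k) ->
  separated D d0 g n eps l -> INR (length l) <= 1 + INR n * (C * F ^ n).
Proof.
  intros Heta He HC HF Hcount Hsep.
  assert (HFn : 0 <= INR n * (C * F ^ n)).
  { apply Rmult_le_pos; [apply pos_INR|]. apply Rmult_le_pos; [easy | apply pow_le; lra]. }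
  assert (l = nil \/ l <> nil) as [->|Hl] by (destruct l; [now left | now right]).
  { simpl. lra. }
  destruct (list_Rmax l Hl) as [m [Hm Hm1]].
  assert (Hd : NoDup l) by apply Hsep.
  set (choice := fun x => epsilon (inhabits (0%nat, 0)) (marks eta n l x)).
  assert (Hch : forall x, In x l -> x <> m -> marks eta n l x (choice x)).
  { intros x Hx Hxm. unfold choice. apply epsilon_spec.
    apply (marks_exist eps eta n l x m); auto. specialize (Hm1 x Hx). lra. }
  destruct (in_split _ _ Hm) as [l1 [l2 Hl12]].
  assert (Hd' : NoDup (l1 ++ l2)) by (apply NoDup_remove_1 with m; now rewrite <- Hl12).
  assert (Hni : ~ In m (l1 ++ l2)) by (apply NoDup_remove_2; now rewrite <- Hl12).
  assert (Hin : forall x, In x (l1 ++ l2) -> In x l /\ x <> m).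
  { intros x Hx. split; [|intros ->; easy]. rewrite Hl12.
    apply in_app_or in Hx. apply in_or_app. simpl. tauto. }
  assert (Hlen : INR (length l) = 1 + INR (length (l1 ++ l2))).
  { rewrite Hl12, !length_app. simpl length. rewrite Nat.add_succ_r, S_INR. ring. }
  rewrite Hlen. apply Rplus_le_compat_l.
  replace (INR (length (l1 ++ l2))) with (wsum (fun _ => 1) (l1 ++ l2))
    by (rewrite wsum_const; ring).
  replace (INR n) with (INR (length (seq 0 n))) by now rewrite length_seq.
  apply wsum_cover with (P := fun k x => fst (choice x) = k); auto.
  - intros x Hx. destruct (Hin x Hx) as [Hxl Hxm]. exists (fst (choice x)). split; [|easy].
    specialize (Hch x Hxl Hxm). destruct (choice x) as [k y]. apply in_seq.
    destruct Hch as [Hk _]. simpl. lia.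
  - intros k Hk Y HY Hi Hkey. apply in_seq in Hk. rewrite wsum_const, Rmult_1_l.
    assert (Hmk : forall x, In x Y -> marks eta n l x (k, snd (choice x))).
    { intros x Hx. destruct (Hin x (Hi x Hx)) as [Hxl Hxm].
      specialize (Hch x Hxl Hxm). specialize (Hkey x Hx).
      destruct (choice x) as [k' y]. simpl in *. now subst. }
    assert (Hlt : forall x x', In x Y -> In x' Y -> x < x' -> snd (choice x) < x' <= snd (choice x')).
    { intros x x' Hx Hx' Hxx. destruct (Hmk x Hx) as [_ [_ [_ [_ [_ H1]]]]].
      destruct (Hmk x' Hx') as [_ [_ [_ [H2 _]]]].
      split; [|easy]. now apply H1; [apply Hin, Hi|]. }
    rewrite <- (length_map (fun x => snd (choice x)) Y).
    apply Rle_trans with (C * F ^ k).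
    + apply Hcount.
      * apply Injective_map_NoDup_in; [|easy]. intros x x' Hx Hx' Heq.
        destruct (Rtotal_order x x') as [H|[H|H]]; [|easy|].
        -- specialize (Hlt x x' Hx Hx' H). simpl in Heq. lra.
        -- specialize (Hlt x' x Hx' Hx H). simpl in Heq. lra.
      * intros y Hy. apply in_map_iff in Hy as [x [<- Hx]].
        destruct (Hmk x Hx) as [_ [H1 [H2 _]]]. now split.
      * intros y y' Hy Hy' Hyy. apply in_map_iff in Hy as [x [<- Hx]].
        apply in_map_iff in Hy' as [x' [<- Hx']].
        assert (Hxx : x < x').
        { destruct (Rtotal_order x x') as [H|[H|H]]; [easy | subst; lra |].
          specialize (Hlt x' x Hx' Hx H). lra. }
        destruct (Hmk x Hx) as [_ [_ [_ [_ [_ H1]]]]].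
        destruct (H1 x' ltac:(now apply Hin, Hi) Hxx) as [_ [u [v [Hu [Hv H2]]]]].
        specialize (Hlt x x' Hx Hx' Hxx).
        exists u, v. cbn beta. split; [lra|]. split; [lra | easy].
      * intros y Hy. apply in_map_iff in Hy as [x [<- Hx]].
        now destruct (Hmk x Hx) as [_ [_ [_ [_ [H1 _]]]]].
    + apply Rmult_le_compat_l; [easy|]. apply Rle_pow; [easy | lia].
Qed.

End SeparatedFamilies.

Variables (f f1 : R -> R) (M B K0 rho h : R) (r1 p : nat).
Hypothesis Hf : base_map U D d0 f f1 M.
Hypothesis HB : 1 <= B.
Hypothesis Hp : (1 <= p)%nat.
Hypothesis Hrho : 0 < rho.
Hypothesis HK0 : K0 < (exp rho ^ S r1) ^ p.
Hypothesis Hgrowth : forall x, U x -> Rabs (deriv_iter f f1 p x) <= K0.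
Hypothesis Hh : h < rho.
Hypothesis Hent : Rbar_lt (htop D d0 f) h.

Lemma entropy_upper_bound (L : R) : rho < L -> exists tau, 0 < tau <= 1 /\
  forall g g1, near U d0 f f1 tau g g1 -> yomdin_split U r1 B g g1 ->
  Rbar_le (htop D d0 g) L.
Proof.
  intros HL. assert (HM := bm_M _ _ _ _ _ _ Hf).
  assert (HE : 1 < exp rho) by (rewrite <- exp_0; now apply exp_increasing).
  destruct (Nat.eq_dec r1 0) as [Hr0|Hr0].
  (* For r = 1 the growth of the derivative bounds the separated sets directly; the bisection
     requires r >= 2. *)
  - destruct (near_growth U D d0 f f1 M (exp rho) K0 r1 p) as [tau [Ht Hg]]; auto; [lra|].
    exists tau. split; [easy|]. intros g g1 Hng _.
    apply htop_le; [lra|]. intros eps Heps e He.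
    assert (HMp : 1 <= M ^ p) by (apply pow_ge_1; lra).
    assert (Hq : 0 < M ^ p / eps) by (apply Rdiv_lt_0_compat; lra).
    exists (M ^ p / eps + 1). split; [lra|]. intros n l Hl.
    assert (HEn : 1 <= exp rho ^ n) by (apply pow_ge_1; lra).
    apply Rle_trans with (M ^ p * exp rho ^ n / eps + 1).
    + apply (lipschitz_separated g n); auto; [nra|].
      intros j x y Hj Ux Uy.
      apply Rle_trans with (1 := ps_le _ _ _ HS _ _).
      apply Rle_trans with (1 := Hg g g1 Hng j x y Ux Uy).
      subst r1. rewrite pow_1. apply Rmult_le_compat_r; [apply Rabs_pos|].
      apply Rmult_le_compat_l; [lra|]. apply Rle_pow; [lra | lia].
    + assert (exp rho ^ n <= exp (L + e) ^ n).
      { apply pow_incr. split; [lra|]. left. apply exp_increasing. lra. }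
      replace (M ^ p * exp rho ^ n / eps) with (M ^ p / eps * exp rho ^ n) by (field; lra). nra.
  - assert (Hcr : 0 < 4 * INR (2 ^ r1) * 4 ^ r1 * B ^ 2).
    { assert (0 < 4 ^ r1) by (apply pow_lt; lra). assert (0 < B ^ 2) by (apply pow_lt; lra).
      assert (0 < INR (2 ^ r1)).
      { apply lt_0_INR. assert (2 ^ r1 <> 0)%nat by (apply Nat.pow_nonzero; lia). lia. }
      repeat apply Rmult_lt_0_compat; lra. }
    set (Q := 4 * INR (2 ^ r1) * 4 ^ r1 * B ^ 2) in *.
    destruct (family_count U D d0 f f1 M (exp rho) B (Rmin 1 (/ Q)) r1 Hf) with (e := L - rho)
      as [tau [Ht Hc]]; [lra | | | lra |].
    { split; [|apply Rmin_l]. apply Rmin_pos; [lra | now apply Rinv_0_lt_compat]. }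
    { intros sigma Hs. apply (window U D d0 f f1 M (exp rho) B K0 r1 p); auto; try lra; try lia.
      - now apply (entropy_spanning f f1 M h rho Hf); [|lra|].
      - fold Q. apply Rle_trans with (Q * / Q).
        + apply Rmult_le_compat_l; [lra|].
          apply Rle_trans with (Rmin 1 (/ Q)); [lra | apply Rmin_r].
        + right. field. lra. }
    exists tau. split; [easy|]. intros g g1 Hng Hy.
    apply htop_le; [lra|]. intros eps Heps e He.
    set (eta := Rmin 1 (eps / 2)).
    assert (Heta : 0 < eta <= 1).
    { split; [|apply Rmin_l]. apply Rmin_pos; lra. }
    destruct (Hc g g1 Hng Hy eta Heta) as [C [HC0 HC]].
    rewrite <- exp_plus in HC. replace (rho + (L - rho)) with L in HC by ring.
    assert (HEL : 1 < exp L) by (rewrite <- exp_0; apply exp_increasing; lra).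
    assert (HCe : 0 <= C / e) by (apply Rcomplements.Rdiv_le_0_compat; lra).
    (* The linear factor is absorbed by [INR n * e <= exp e ^ n]. *)
    exists (1 + C / e). split; [lra|]. intros n l Hl.
    apply Rle_trans with (1 + INR n * (C * exp L ^ n)).
    + apply (separated_count g g1 (nr_U _ _ _ _ _ _ _ Hng) (nr_deriv _ _ _ _ _ _ _ Hng) eps eta);
        auto; try lra. apply Rmin_r.
    + rewrite exp_plus, Rpow_mult_distr.
      assert (H1 : 1 <= exp L ^ n) by (apply pow_ge_1; lra).
      assert (H2 : 1 <= exp e ^ n).
      { apply pow_ge_1. rewrite <- exp_0. left. now apply exp_increasing. }
      assert (H3 : INR n * e <= exp e ^ n).
      { rewrite <- (exp_ln (exp e ^ n)) by (apply pow_lt, exp_pos).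
        rewrite ln_pow, ln_exp by apply exp_pos.
        assert (A := exp_ineq1_le (INR n * e)). lra. }
      assert (H4 : INR n * C <= C / e * exp e ^ n).
      { replace (INR n * C) with (C / e * (INR n * e)) by (field; lra).
        now apply Rmult_le_compat_l. }
      assert (H5 : INR n * C * exp L ^ n <= C / e * exp e ^ n * exp L ^ n).
      { apply Rmult_le_compat_r; lra. }
      nra.
Qed.

End Entropy.

(** * The interval and the circle *)

Lemma CrOn_le U k r f D : le_r k r -> CrOn U r f D -> CrOn U (Some k) f D.
Proof.
  intros Hk [H1 [H2 H3]].
  assert (Hle : forall j, (j <= k)%nat -> le_r j r).
  { intros j Hj. destruct r as [m|]; simpl in *; [lia | easy]. }
  repeat split; auto.
Qed.

Lemma CrOn_deriv_1 U r f D : le_r 1 r -> CrOn U r f D ->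
  forall x, U x -> has_deriv_within U f x (D 1%nat x).
Proof.
  intros Hr [H1 [H2 _]] x Ux. apply has_deriv_within_ext with (D 0%nat); auto.
Qed.

Lemma CrOn_unique U k f D D' : no_isolated_point U -> CrOn U (Some k) f D -> CrOn U (Some k) f D' ->
  forall j, (j <= k)%nat -> forall x, U x -> D j x = D' j x.
Proof.
  intros Ha [H1 [H2 _]] [H1' [H2' _]]. induction j as [|j IH]; intros Hj x Ux.
  - now rewrite H1, H1'.
  - apply (has_deriv_within_unique U (D j) x); auto.
    apply has_deriv_within_ext with (D' j); auto.
    intros y Uy. symmetry. apply IH; [lia | easy].
Qed.

(** Closeness comes with its own derivatives of [f]. Uniqueness identifies them with [D], so the
    bound on the top derivative passes to [g] with 1 added. *)
Lemma CkClose_near U d0 r1 f g D B0 delta : convex_set U -> no_isolated_point U ->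
  CrOn U (Some (S r1)) f D -> (forall x, U x -> Rabs (D (S r1) x) <= B0) ->
  (forall x, U x -> U (g x)) -> delta <= 1 -> CkClose U d0 (S r1) f g delta ->
  exists g1, near U d0 f (D 1%nat) delta g g1 /\ yomdin_split U r1 (B0 + 1) g g1.
Proof.
  intros Hc Ha HD HB0 HgU Hdelta [Df [Dg [HDf [HDg [Hd0 Hdj]]]]].
  assert (Heq := CrOn_unique U (S r1) f Df D Ha HDf HD).
  exists (Dg 1%nat). split.
  - split; auto.
    + apply (CrOn_deriv_1 U (Some (S r1))); [simpl; lia | easy].
    + intros x Ux. rewrite <- Heq by (auto; lia). apply Hdj; [lia | easy].
  - intros u v Uu Uv Huv. destruct HDg as [G1 [G2 G3]].
    assert (Htop : forall x, U x -> Rabs (Dg (S r1) x) <= B0 + 1).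
    { intros x Ux. assert (A := Hdj (S r1) x ltac:(lia) Ux). specialize (HB0 x Ux).
      rewrite Heq in A by (auto; lia).
      replace (Dg (S r1) x) with (D (S r1) x - (D (S r1) x - Dg (S r1) x)) by ring.
      apply Rle_trans with (1 := Rabs_triang _ _). rewrite Rabs_Ropp. lra. }
    apply (tower_split_mono U (S r1) Dg); auto.
    apply Rle_trans with (2 := Htop u Uu). apply Rabs_pos.
Qed.

Lemma pow_exp (x : R) (n : nat) : exp x ^ n = exp (INR n * x).
Proof.
  rewrite <- (exp_ln (exp x ^ n)) by (apply pow_lt, exp_pos).
  now rewrite ln_pow, ln_exp by apply exp_pos.
Qed.

(** If all the quotients from time 1 on were at least [a], so would be their limit; a time with a
    smaller quotient is the required [p]. Positivity of [a] comes from [log_plus]. *)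
Lemma Rrate_growth U D d0 f f1 M (a : R) : phase_space U D d0 -> base_map U D d0 f f1 M ->
  Rbar_lt (Rrate U f) a -> 0 < a /\ exists p K0, (1 <= p)%nat /\ K0 < exp a ^ p /\
  forall x, U x -> Rabs (deriv_iter f f1 p x) <= K0.
Proof.
  intros HS Hf Ha. assert (HM := bm_M _ _ _ _ _ _ Hf).
  assert (Hex : exists p, (1 <= p)%nat /\
    log_plus (real (sup_deriv U (iter f p))) / INR p < a).
  { apply NNPP. intros Hn. apply (Rbar_lt_not_le _ _ Ha).
    rewrite <- (Lim_seq_const a). apply Lim_seq_le_loc. exists 1%nat. intros n Hn1.
    apply Rnot_lt_le. intros Hlt. apply Hn. now exists n. }
  destruct Hex as [p [Hp Hlt]].
  assert (Hp0 : 0 < INR p) by (apply lt_0_INR; lia).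
  apply Rlt_div_l in Hlt; [|easy]. unfold log_plus in Hlt.
  set (s := sup_deriv U (iter f p)) in *.
  assert (L1 := Rmax_l (ln (real s)) 0). assert (L2 := Rmax_r (ln (real s)) 0).
  split; [nra|]. exists p, (real s). split; [easy|]. split.
  - rewrite pow_exp. destruct (Rlt_dec 0 (real s)) as [Hs|Hs].
    + rewrite <- (exp_ln (real s)) by easy. apply exp_increasing. lra.
    + apply Rle_lt_trans with 0; [lra | apply exp_pos].
  - intros x Ux. unfold s, sup_deriv.
    assert (Hder := has_deriv_within_iter U f f1 (bm_U _ _ _ _ _ _ Hf) (bm_deriv _ _ _ _ _ _ Hf) p).
    destruct (Lub_Rbar_correct (fun t => exists x L, U x /\ has_deriv_within U (iter f p) x L /\
      t = Rabs L)) as [H1 H2].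
    (* [real] sends infinite values to 0; the bound M^p shows that the supremum is finite. *)
    assert (Hu : Rbar_le (Lub_Rbar (fun t => exists x L, U x /\
      has_deriv_within U (iter f p) x L /\ t = Rabs L)) (M ^ p)).
    { apply H2. intros t [y [L [Uy [HL ->]]]]. simpl.
      rewrite (has_deriv_within_unique U (iter f p) y L (deriv_iter f f1 p y)
        (ps_acc _ _ _ HS) Uy HL (Hder y Uy)).
      apply (deriv_iter_bound U); auto; [apply (bm_U _ _ _ _ _ _ Hf)|].
      intros z Uz. assert (A := bm_bound _ _ _ _ _ _ Hf z Uz). lra. }
    assert (Hlo : Rbar_le (Rabs (deriv_iter f f1 p x)) (Lub_Rbar (fun t => exists x L, U x /\
      has_deriv_within U (iter f p) x L /\ t = Rabs L))).
    { apply H1. exists x, (deriv_iter f f1 p x). auto. }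
    destruct (Lub_Rbar _); simpl in *; easy.
Qed.

Lemma Rbar_max_lt (x y l : Rbar) : Rbar_lt (Rbar_max x y) l -> Rbar_lt x l /\ Rbar_lt y l.
Proof.
  unfold Rbar_max. destruct (Rbar_le_dec x y) as [H|H]; intros Hl; split; auto.
  - now apply Rbar_le_lt_trans with y.
  - apply Rbar_not_le_lt in H. now apply Rbar_lt_trans with x.
Qed.

Lemma Rbar_lt_dense (x : Rbar) (l : R) : Rbar_lt x l -> exists m : R, Rbar_lt x m /\ m < l.
Proof.
  destruct x as [x| |]; simpl; intros H; try easy.
  - exists ((x + l) / 2). simpl. lra.
  - exists (l - 1). simpl. split; [easy | lra].
Qed.

Lemma Cr_limsup_bound U D d0 P r f Df M : phase_space U D d0 ->
  (forall g, P r g -> forall x, U x -> U (g x)) -> le_r 1 r -> CrOn U r f Df ->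
  base_map U D d0 f (Df 1%nat) M ->
  (forall k, (1 <= k)%nat -> le_r k r -> exists B0, forall x, U x -> Rabs (Df k x) <= B0) ->
  Rbar_le (Cr_limsup U d0 P r (htop D d0) f) (Rbar_max (htop D d0 f) (div_r (Rrate U f) r)).
Proof.
  intros HS HP Hr HD Hf HB. apply Rbar_le_of_gt. intros L HL.
  destruct (Rbar_lt_dense _ _ HL) as [h [Hh HhL]]. apply Rbar_max_lt in Hh as [Hh1 Hh2].
  set (rho := (h + L) / 2). assert (Hhr : h < rho < L) by (unfold rho; lra).
  assert (Hk : exists r1 p K0, le_r (S r1) r /\ 0 < rho /\ (1 <= p)%nat /\
    K0 < (exp rho ^ S r1) ^ p /\ forall x, U x -> Rabs (deriv_iter f (Df 1%nat) p x) <= K0).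
  { destruct r as [m|]; cbn [div_r le_r] in Hr, Hh2.
    - destruct m as [|m]; [lia|].
      assert (Hm : 0 < INR (S m)) by (apply lt_0_INR; lia).
      destruct (Rrate_growth U D d0 f (Df 1%nat) M (INR (S m) * h)) as [Hpos [p [K0 [Hp [HK HG]]]]];
        auto.
      { assert (Hi : 0 < / INR (S m)) by now apply Rinv_0_lt_compat.
        destruct (Rrate U f) as [x| |]; simpl Rbar_lt; auto.
        - change (x * / INR (S m) < h) in Hh2.
          change (x < INR (S m) * h). rewrite Rmult_comm. apply Rlt_div_l; [easy | exact Hh2].
        - unfold Rbar_mult, Rbar_mult' in Hh2.
          destruct (Rle_dec 0 (/ INR (S m))) as [H0|H0]; [|lra].
          destruct (Rle_lt_or_eq_dec 0 (/ INR (S m)) H0); [easy | lra]. }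
      assert (0 < h) by nra.
      exists m, p, K0. repeat split; auto; [simpl; lia | lra |].
      apply Rlt_le_trans with (1 := HK). rewrite pow_exp. rewrite <- pow_mult, pow_exp.
      rewrite mult_INR.
      assert (INR p * (INR (S m) * h) <= INR (S m) * INR p * rho).
      { replace (INR p * (INR (S m) * h)) with (INR (S m) * INR p * h) by ring.
        apply Rmult_le_compat_l; [|lra]. apply Rmult_le_pos; [lra | apply pos_INR]. }
      destruct H0 as [Hlt| ->]; [left; now apply exp_increasing | right; easy].
    (* For r = +oo the order is free: it is taken so large that exp(rho)^(S r1) exceeds [M], and
       already the first derivative satisfies the growth condition, with p = 1. *)
    - change (0 < h) in Hh2.
      assert (HE : 1 < exp rho) by (rewrite <- exp_0; apply exp_increasing; lra).
      assert (HM := bm_M _ _ _ _ _ _ Hf).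
      destruct (Pow_x_infinity (exp rho)) with (b := M) as [r1 Hr1].
      { rewrite Rabs_pos_eq; lra. }
      specialize (Hr1 (S r1) ltac:(lia)). rewrite Rabs_pos_eq in Hr1 by (apply pow_le; lra).
      exists r1, 1%nat, (M - 1). repeat split; auto; [lra | rewrite pow_1; lra |].
      intros x Ux. simpl. rewrite Rmult_1_r. now apply (bm_bound _ _ _ _ _ _ Hf). }
  destruct Hk as [r1 [p [K0 [Hkr [Hrho [Hp [HK HG]]]]]]].
  destruct (HB (S r1) ltac:(lia) Hkr) as [B0 HB0].
  set (B1 := Rmax 0 B0).
  assert (HB1 : forall x, U x -> Rabs (Df (S r1) x) <= B1).
  { intros x Ux. apply Rle_trans with (1 := HB0 x Ux), Rmax_r. }
  assert (HB1p : 0 <= B1) by apply Rmax_l.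
  destruct (entropy_upper_bound U D d0 HS f (Df 1%nat) M (B1 + 1) K0 rho h r1 p)
    with (L := L) as [tau [Ht Htau]]; auto; try lra.
  unfold Cr_limsup, Rbar_glb. destruct (Rbar_ex_glb _) as [b [Hb Hb0]]. simpl.
  assert (Hlow : Rbar_le b (Rbar_lub (fun t => exists g, P r g /\ CkClose U d0 (S r1) f g tau /\
    t = htop D d0 g))).
  { apply Hb. exists (S r1), tau. repeat split; [easy | lra]. }
  apply Rbar_le_trans with (1 := Hlow).
  unfold Rbar_lub. destruct (Rbar_ex_lub _) as [c [Hc Hc0]]. simpl.
  apply Hc0. intros t [g [HPg [Hcl ->]]].
  destruct (CkClose_near U d0 r1 f g Df B1 tau (ps_convex _ _ _ HS) (ps_acc _ _ _ HS)
    (CrOn_le U (S r1) r f Df Hkr HD) HB1 (HP g HPg) ltac:(lra) Hcl) as [g1 [Hng Hyg]].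
  now apply (Htau g g1).
Qed.

Lemma segment_bounded U h u v : convex_set U -> U u -> U v -> u <= v -> cont_within U h ->
  exists B, forall x, u <= x <= v -> Rabs (h x) <= B.
Proof.
  intros Hc Uu Uv Huv Hh.
  destruct (continuity_ab_maj (fun x => Rabs (h (clamp u v x))) u v Huv) as [m [Hm _]].
  - intros x _. apply (continuity_pt_comp (fun x => h (clamp u v x)) Rabs).
    + now apply (clamp_continuous U).
    + apply Rcontinuity_abs.
  - exists (Rabs (h (clamp u v m))). intros x Hx. specialize (Hm x Hx). simpl in Hm.
    now rewrite (clamp_id u v x) in Hm.
Qed.

Lemma segment_uniform U h u v : convex_set U -> U u -> U v -> u <= v -> cont_within U h ->
  forall e, 0 < e -> exists tau, 0 < tau /\
  forall x y, u <= x <= v -> u <= y <= v -> Rabs (x - y) <= tau -> Rabs (h x - h y) <= e.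
Proof.
  intros Hc Uu Uv Huv Hh e He.
  assert (Hcl : forall x, u <= x <= v -> continuity_pt (fun x => h (clamp u v x)) x).
  { intros x _. now apply (clamp_continuous U). }
  destruct (Heine_cor2 Hcl (mkposreal e He)) as [d Hd].
  exists (d / 2). assert (Hd0 := cond_pos d). split; [lra|].
  intros x y Hx Hy Hxy. specialize (Hd x y Hx Hy ltac:(lra)).
  rewrite 2!clamp_id in Hd by lra. simpl in Hd. lra.
Qed.

Lemma interval_phase_space : phase_space I01 I01 dI.
Proof.
  unfold I01, dI. split.
  - intros x y z Hx Hy Hz. lra.
  - intros x Hx d Hd.
    destruct (Rle_dec x (/ 2)).
    + exists (x + Rmin (/ 2) (d / 2)). assert (A := Rmin_l (/ 2) (d / 2)).
      assert (A' := Rmin_r (/ 2) (d / 2)).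
      assert (0 < Rmin (/ 2) (d / 2)) by (apply Rmin_pos; lra).
      split; [lra|]. split; [lra|]. rewrite Rabs_pos_eq; lra.
    + exists (x - Rmin (/ 2) (d / 2)). assert (A := Rmin_l (/ 2) (d / 2)).
      assert (A' := Rmin_r (/ 2) (d / 2)).
      assert (0 < Rmin (/ 2) (d / 2)) by (apply Rmin_pos; lra).
      split; [lra|]. split; [lra|]. rewrite Rabs_left1; lra.
  - intros x Hx. easy.
  - intros x y z. replace (x - z) with ((x - y) + (y - z)) by ring. apply Rabs_triang.
  - intros x y. apply Rabs_minus_sym.
  - intros x y. lra.
  - easy.
Qed.

(** Together with [dC_le] this characterises [dC x y] as the minimum of |x - y - n| over the
    integers n, from which the metric properties follow. *)
Lemma dC_attained x y : exists n, dC x y = Rabs (x - y - IZR n).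
Proof.
  unfold dC. destruct (base_Int_part (x - y)) as [H1 H2].
  set (k := Int_part (x - y)) in *.
  destruct (Rle_dec (x - y - IZR k) (1 - (x - y - IZR k))).
  - exists k. rewrite Rmin_left, Rabs_pos_eq; lra.
  - exists (k + 1)%Z. rewrite plus_IZR, Rmin_right, Rabs_left1; lra.
Qed.

Lemma dC_le x y n : dC x y <= Rabs (x - y - IZR n).
Proof.
  unfold dC. destruct (base_Int_part (x - y)) as [H1 H2].
  set (k := Int_part (x - y)) in *.
  destruct (BinInt.Z.le_gt_cases n k) as [H|H].
  - apply IZR_le in H. rewrite Rabs_pos_eq by lra.
    apply Rle_trans with (1 := Rmin_l _ _). lra.
  - assert (Hn : (k + 1 <= n)%Z) by lia. apply IZR_le in Hn. rewrite plus_IZR in Hn.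
    rewrite Rabs_left1 by lra. apply Rle_trans with (1 := Rmin_r _ _). lra.
Qed.

Lemma dC_shift x y n : dC (x + IZR n) y = 0 -> dC x y = 0.
Proof.
  intros H. destruct (dC_attained (x + IZR n) y) as [m Hm].
  assert (A := dC_le x y (m - n)). rewrite minus_IZR in A.
  replace (x - y - (IZR m - IZR n)) with (x + IZR n - y - IZR m) in A by ring.
  destruct (dC_attained x y) as [l Hl].
  assert (0 <= dC x y) by (rewrite Hl; apply Rabs_pos). lra.
Qed.

Lemma circle_phase_space : phase_space whole C01 dC.
Proof.
  split.
  - easy.
  - intros x _ d Hd. exists (x + d / 2). split; [easy|]. split; [lra|].
    rewrite Rabs_pos_eq; lra.
  - intros x [H1 H2]. split; [easy | lra].
  - intros x y z. destruct (dC_attained x y) as [n ->]. destruct (dC_attained y z) as [m ->].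
    apply Rle_trans with (1 := dC_le x z (n + m)). rewrite plus_IZR.
    replace (x - z - (IZR n + IZR m)) with ((x - y - IZR n) + (y - z - IZR m)) by ring.
    apply Rabs_triang.
  - assert (H : forall x y, dC x y <= dC y x).
    { intros x y. destruct (dC_attained y x) as [n ->].
      apply Rle_trans with (1 := dC_le x y (- n)). rewrite opp_IZR.
      rewrite <- Rabs_Ropp. right. f_equal. ring. }
    intros x y. apply Rle_antisym; apply H.
  - intros x y. apply Rle_trans with (1 := dC_le x y 0). rewrite Rminus_0_r. lra.
  - intros x y Hxy. apply Rle_antisym.
    + apply Rle_trans with (1 := dC_le x y 0). rewrite Rminus_0_r. lra.
    + destruct (dC_attained x y) as [n ->].
      destruct (BinInt.Z.le_gt_cases n (-1)) as [H|H].
      * apply IZR_le in H. revert Hxy. unfold Rabs. repeat destruct Rcase_abs; lra.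
      * destruct (BinInt.Z.le_gt_cases n 0) as [H0|H0].
        -- replace n with 0%Z by lia. rewrite Rminus_0_r. lra.
        -- assert (H1 : (1 <= n)%Z) by lia. apply IZR_le in H1.
           revert Hxy. unfold Rabs. repeat destruct Rcase_abs; lra.
Qed.

Lemma interval_base_map r f D : le_r 1 r -> (forall x, I01 x -> I01 (f x)) -> CrOn I01 r f D ->
  exists M, base_map I01 I01 dI f (D 1%nat) M.
Proof.
  intros Hr HfU HD. assert (HS := interval_phase_space).
  assert (U0 : I01 0) by (unfold I01; lra). assert (U1 : I01 1) by (unfold I01; lra).
  assert (Hder := CrOn_deriv_1 I01 r f D Hr HD).
  assert (Hc1 : cont_within I01 (D 1%nat)) by now apply HD.
  destruct (segment_bounded I01 (D 1%nat) 0 1 (ps_convex _ _ _ HS) U0 U1 ltac:(lra) Hc1) as [B HB].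
  exists (Rmax 2 (B + 1)). assert (L1 := Rmax_l 2 (B + 1)). assert (L2 := Rmax_r 2 (B + 1)).
  split; auto.
  - intros x Hx. specialize (HB x Hx). lra.
  - intros e He. destruct (segment_uniform I01 (D 1%nat) 0 1 (ps_convex _ _ _ HS) U0 U1
      ltac:(lra) Hc1 e He) as [tau [Ht H]].
    exists tau. split; [easy|]. intros x y Hx Hy Hxy. now apply H.
  - intros x y Hx Hy. unfold dI.
    apply (within_contraction I01 f (D 1%nat) _ 0 1); auto; try lra.
    + apply (ps_convex _ _ _ HS).
    + intros z Hz. specialize (HB z Hz). lra.
  - intros x Hx. exists x. split; [easy|]. intros k. unfold dI. now rewrite Rminus_diag, Rabs_R0.
Qed.

Lemma periodic_shift h c (n : Z) : (forall x, h (x + 1) = h x + c) ->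
  forall x, h (x + IZR n) = h x + IZR n * c.
Proof.
  intros H.
  assert (Hn : forall n x, h (x + INR n) = h x + INR n * c).
  { induction n0 as [|m IH]; intros x.
    - simpl. rewrite Rplus_0_r. ring.
    - rewrite S_INR, <- Rplus_assoc, H, IH. ring. }
  intros x. destruct (BinInt.Z.le_gt_cases 0 n) as [H0|H0].
  - rewrite <- (Znat.Z2Nat.id n) by lia. rewrite <- INR_IZR_INZ. apply Hn.
  - assert (A := Hn (BinInt.Z.to_nat (- n)) (x + IZR n)).
    rewrite INR_IZR_INZ, Znat.Z2Nat.id, opp_IZR in A by lia.
    replace (x + IZR n + - IZR n) with x in A by ring. lra.
Qed.

Lemma deriv_periodic h h1 c : (forall x, h (x + 1) = h x + c) ->
  (forall x, has_deriv_within whole h x (h1 x)) -> forall x, h1 (x + 1) = h1 x.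
Proof.
  intros Hp Hd x.
  apply (has_deriv_within_unique whole h x); auto.
  - apply (ps_acc _ _ _ circle_phase_space).
  - easy.
  - intros e He. destruct (Hd (x + 1) e He) as [d [Hd0 H]]. exists d. split; [easy|].
    intros y _ Hn Hy. specialize (H (y + 1) I).
    rewrite 2!Hp in H. replace (y + 1 - (x + 1)) with (y - x) in H by ring.
    replace (h y + c - (h x + c)) with (h y - h x) in H by ring.
    apply H; [lra | easy].
Qed.

(** The lift is periodic only up to its degree, but its derivatives are periodic; bounds and uniform
    continuity on the line thus reduce to a compact segment. *)
Lemma circle_tower_periodic r F D (d : Z) : (forall x, F (x + 1) = F x + IZR d) ->
  CrOn whole r F D -> forall k, le_r (S k) r -> forall x, D (S k) (x + 1) = D (S k) x + 0.
Proof.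
  intros HF [H1 [H2 _]]. induction k as [|k IH]; intros Hk x; rewrite Rplus_0_r.
  - apply (deriv_periodic (D 0%nat) _ (IZR d)).
    + intros y. now rewrite !H1.
    + intros y. now apply H2.
  - apply (deriv_periodic (D (S k)) _ 0).
    + apply IH. destruct r as [m|]; simpl in *; [lia | easy].
    + intros y. now apply H2.
Qed.

Lemma unit_reduction x : exists n, 0 <= x + IZR n < 1.
Proof.
  exists (- Int_part x)%Z. rewrite opp_IZR. destruct (base_Int_part x). lra.
Qed.

Lemma periodic_bounded h : (forall x, h (x + 1) = h x + 0) -> cont_within whole h ->
  exists B, forall x, whole x -> Rabs (h x) <= B.
Proof.
  intros Hp Hc.
  destruct (segment_bounded whole h 0 1 (ps_convex _ _ _ circle_phase_space) I I ltac:(lra) Hc)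
    as [B HB].
  exists B. intros x _. destruct (unit_reduction x) as [n Hn].
  assert (A := periodic_shift h 0 n Hp x). rewrite Rmult_0_r, Rplus_0_r in A.
  rewrite <- A. apply HB. lra.
Qed.

Lemma periodic_uniform h : (forall x, h (x + 1) = h x + 0) -> cont_within whole h ->
  forall e, 0 < e -> exists tau, 0 < tau /\
  forall x y, whole x -> whole y -> dC x y <= tau -> Rabs (h x - h y) <= e.
Proof.
  intros Hp Hc e He.
  (* After [x] is moved into [0,1), the translate of [y] nearest to it lies within distance 1, hence
     in [-1,2]. *)
  destruct (segment_uniform whole h (-1) 2 (ps_convex _ _ _ circle_phase_space) I I
    ltac:(lra) Hc e He) as [tau [Ht H]].
  exists (Rmin 1 tau). split; [apply Rmin_pos; lra|].
  assert (L1 := Rmin_l 1 tau). assert (L2 := Rmin_r 1 tau).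
  intros x y _ _ Hxy. destruct (unit_reduction x) as [n Hn].
  destruct (dC_attained x y) as [m Hm]. rewrite Hm in Hxy.
  assert (Hsh : forall k z, h (z + IZR k) = h z).
  { intros k z. rewrite (periodic_shift h 0 k Hp z). ring. }
  rewrite <- (Hsh n x), <- (Hsh (n + m)%Z y).
  assert (He2 : x + IZR n - (y + IZR (n + m)) = x - y - IZR m) by (rewrite plus_IZR; ring).
  apply H.
  - lra.
  - assert (A : Rabs (x - y - IZR m) <= 1) by lra. apply Rabs_le_between in A. lra.
  - rewrite He2. lra.
Qed.

Lemma circle_base_map r F D (d : Z) : le_r 1 r -> (forall x, F (x + 1) = F x + IZR d) ->
  CrOn whole r F D -> exists M, base_map whole C01 dC F (D 1%nat) M.
Proof.
  intros Hr HF HD.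
  assert (Hder := CrOn_deriv_1 whole r F D Hr HD).
  assert (Hp1 := circle_tower_periodic r F D d HF HD 0 Hr).
  assert (Hc1 : cont_within whole (D 1%nat)) by now apply HD.
  destruct (periodic_bounded (D 1%nat) Hp1 Hc1) as [B HB].
  assert (Hlip : forall x y, Rabs (F x - F y) <= B * Rabs (x - y)).
  { assert (Hw : forall x y, x <= y -> Rabs (F x - F y) <= B * Rabs (x - y)).
    { intros x y Hxy. apply (within_contraction whole F (D 1%nat) _ x y); try easy; try lra.
      intros z _. now apply HB. }
    intros x y. destruct (Rle_dec x y); [auto|].
    rewrite Rabs_minus_sym, (Rabs_minus_sym x). apply Hw. lra. }
  exists (Rmax 2 (B + 1)). assert (L1 := Rmax_l 2 (B + 1)). assert (L2 := Rmax_r 2 (B + 1)).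
  split; auto.
  - intros x Hx. specialize (HB x Hx). lra.
  - now apply periodic_uniform.
  - intros x y _ _. destruct (dC_attained x y) as [n ->].
    (* Translating [y] by n translates its image by n times the degree. *)
    apply Rle_trans with (1 := dC_le (F x) (F y) (n * d)).
    rewrite mult_IZR.
    replace (F x - F y - IZR n * IZR d) with (F x - F (y + IZR n))
      by (rewrite (periodic_shift F (IZR d) n HF); ring).
    apply Rle_trans with (1 := Hlip _ _).
    replace (x - (y + IZR n)) with (x - y - IZR n) by ring.
    apply Rmult_le_compat_r; [apply Rabs_pos | lra].
  - intros x _. destruct (unit_reduction x) as [n Hn]. exists (x + IZR n). split; [easy|].
    intros k. assert (Hk : exists m, iter F k (x + IZR n) = iter F k x + IZR m).
    { induction k as [|k [m IH]]; [now exists n|].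
      exists (m * d)%Z. simpl. rewrite IH, (periodic_shift F (IZR d) m HF), mult_IZR. ring. }
    destruct Hk as [m ->]. apply dC_shift with m.
    apply Rle_antisym.
    + apply Rle_trans with (1 := dC_le _ _ 0). rewrite Rminus_0_r, Rminus_diag, Rabs_R0. lra.
    + destruct (dC_attained (iter F k x + IZR m) (iter F k x + IZR m)) as [l ->]. apply Rabs_pos.
Qed.

Theorem mainTheorem1 (r : reg) (hr : le_r 1 r) :
  (forall f : R -> R, IntervalMap r f ->
     Rbar_le (Cr_limsup I01 dI IntervalMap r htop_interval f)
             (Rbar_max (htop_interval f) (div_r (Rrate I01 f) r))) /\
  (forall F : R -> R, CircleMap r F ->
     Rbar_le (Cr_limsup whole dC CircleMap r htop_circle F)
             (Rbar_max (htop_circle F) (div_r (Rrate whole F) r))).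
Proof.
  split.
  - intros f [HfU [D HD]]. destruct (interval_base_map r f D hr HfU HD) as [M HM].
    apply (Cr_limsup_bound I01 I01 dI IntervalMap r f D M); auto.
    + apply interval_phase_space.
    + now intros g [Hg _].
    + intros k _ Hk.
      destruct (segment_bounded I01 (D k) 0 1 (ps_convex _ _ _ interval_phase_space))
        as [B0 HB0]; try (unfold I01; lra); [now apply HD | now exists B0].
  - intros F [[d HF] [D HD]]. destruct (circle_base_map r F D d hr HF HD) as [M HM].
    apply (Cr_limsup_bound whole C01 dC CircleMap r F D M); auto.
    + apply circle_phase_space.
    + intros k Hk1 Hk. destruct k as [|k]; [lia|].
      apply periodic_bounded; [now apply (circle_tower_periodic r F D d) | now apply HD].
Qed.
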